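(* Let $\mathcal H$ be a nonlinear connection on $E^*=J^{1*}(\mathcal T,M)$ (in i)–iii)), and work in induced coordinate charts $(t^a,x^i,p^a_i)$ of $E^*$. i) On each such chart there exist unique, linearly independent, horizontal vector fields $\dfrac{\delta}{\delta t^a},\dfrac{\delta}{\delta x^i}\in\mathcal S(\mathcal H)$ with the properties $$\pi^*{}_*\left(\frac{\delta}{\delta t^a}\right)=\frac{\partial}{\partial t^a},\qquad \pi^*{}_*\left(\frac{\delta}{\delta x^i}\right)=\frac{\partial}{\partial x^i}.$$ ii) These horizontal vector fields can be uniquely written in the form $$\frac{\delta}{\delta t^a}=\frac{\partial}{\partial t^a}-\underset{1}{N}{}^{(b)}_{(j)a}\frac{\partial}{\partial p^b_j},\qquad \frac{\delta}{\delta x^i}=\frac{\partial}{\partial x^i}-\underset{2}{N}{}^{(b)}_{(j)i}\frac{\partial}{\partial p^b_j}.$$ iii) With respect to a transformation of induced coordinates on $E^*$, the coefficients $\underset{1}{N}{}^{(b)}_{(j)a}$ and $\underset{2}{N}{}^{(b)}_{(j)i}$ obey the rules $$\underset{1}{\tilde N}{}^{(b)}_{(j)c}\frac{\partial\tilde t^c}{\partial t^a}=\underset{1}{N}{}^{(c)}_{(k)a}\frac{\partial\tilde t^b}{\partial t^c}\frac{\partial x^k}{\partial\tilde x^j}-\frac{\partial\tilde p^b_j}{\partial t^a},\qquad \underset{2}{\tilde N}{}^{(b)}_{(j)k}\frac{\partial\tilde x^k}{\partial x^i}=\underset{2}{N}{}^{(c)}_{(k)i}\frac{\partial\tilde t^b}{\partial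 t^c}\frac{\partial x^k}{\partial\tilde x^j}-\frac{\partial\tilde p^b_j}{\partial x^i}.$$ iv) To give a nonlinear connection $\mathcal H$ on $E^*$ is equivalent to giving (on every induced chart) a set of local functions $N=\left(\underset{1}{N}{}^{(b)}_{(j)a},\underset{2}{N}{}^{(b)}_{(j)i}\right)$ which transform by the rules in iii).
   Context: All objects are smooth ($C^\infty$). $\mathcal T$ and $M$ are smooth manifolds of dimensions $m$ and $n$ with local coordinates $(t^a)$ and $(x^i)$. Indices $a,b,c,d,e,f,g,h$ run over $\{1,\dots,m\}$, indices $i,j,k,l,p,q,r,s$ over $\{1,\dots,n\}$; the Einstein summation convention is used. $E^*=J^{1*}(\mathcal T,M)$ is the dual of the $1$-jet vector bundle $J^1(\mathcal T,M)\to\mathcal T\times M$; it is a vector bundle $\pi^*:E^*\to\mathcal T\times M$ with fibre $\mathbb R^{mn}$ and induced coordinates $(t^a,x^i,p^a_i)$, whose changes of coordinates are $$\tilde t^a=\tilde t^a(t^b),\quad \tilde x^i=\tilde x^i(x^j),\quad \tilde p^a_i=\frac{\partial x^j}{\partial\tilde x^i}\frac{\partial\tilde t^a}{\partial t^b}p^b_j,$$ with $\det(\partial\tilde t^a/\partial t^b)\ne0$, $\det(\partial\tilde x^i/\partial x^j)\neq0$. In the transformation rules, $\tilde p^b_j$ is differentiated as a function of $(t,x,p)$. The vertical distribution $\mathcal W$ is $u^*\mapsto W_{u^*}=\ker(\pi^*{}_{*,u^*})\subset T_{u^*}E^*$, locally spanned by $\partial/\partial p^a_i$. A nonlinear connection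 on $E^*$ is a smooth distribution $\mathcal H:u^*\mapsto H_{u^*}\subset T_{u^*}E^*$ (the horizontal distribution) such that $T_{u^*}E^*=H_{u^*}\oplus W_{u^*}$ for all $u^*\in E^*$. $\mathcal S(\mathcal H)$ denotes the smooth (local) sections of $\mathcal H$. *)

(* Defs.v *)
From HB Require Import structures.
From mathcomp Require Import all_boot all_order all_algebra.
From mathcomp Require Import all_classical all_reals all_analysis.

Set Implicit Arguments.
Unset Strict Implicit.
Unset Printing Implicit Defensive.

Import Order.TTheory GRing.Theory Num.Theory.
Import numFieldNormedType.Exports.

Local Open Scope classical_set_scope.
Local Open Scope ring_scope.

(* In finite dimension (the only case used) this is the usual C^k: all iterated
   partial derivatives up to order k exist and are continuous on U. *)
Fixpoint Ck (R : realType) (V W : normedModType R) (k : nat) (U : set V)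
    (f : V -> W) : Prop :=
  if k is k'.+1 then
    (forall x, U x -> differentiable f x) /\
    (forall v : V, Ck k' U (fun x => 'D_v f x))
  else forall x, U x -> {for x, continuous f}.

Definition smooth_on (R : realType) (V W : normedModType R) (U : set V)
  (f : V -> W) : Prop := forall k, Ck k U f.

Section LinearSubspaces.
Variables (R : realType) (E F : lmodType R).

Definition linear_subspace (S : set E) : Prop :=
  S 0 /\ forall (a : R) v w, S v -> S w -> S (a *: v + w).

Definition lin_indep (I : finType) (e : I -> E) : Prop :=
  forall a : I -> R, \sum_i a i *: e i = 0 -> forall i, a i = 0.

Definition is_basis (I : finType) (e : I -> E) (S : set E) : Prop :=
  lin_indep e /\ S = [set v | exists a : I -> R, v = \sum_i a i *: e i].

(* Linear maps from the subspace S to the subspace S'.  They are represented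
   by total functions, set to 0 outside S so that equality is Leibniz. *)
Definition lin_maps (S : set E) (S' : set F) : set (E -> F) :=
  [set f | [/\ forall v, S v -> S' (f v),
               forall (a : R) v w, S v -> S w -> f (a *: v + w) = a *: f v + f w
             & forall v, ~ S v -> f v = 0]].

End LinearSubspaces.

(* The function f, defined on D, read in the coordinates phi, i.e. f o phi^-1
   on phi(D) when phi is injective on D. *)
Definition in_coords (R : realType) (X : Type) (V W : normedModType R)
    (D : set X) (phi : X -> V) (f : X -> W) (y : V) : W :=
  xget 0 [set w | exists u, [/\ D u, phi u = y & f u = w]].

(* Charts are total functions used only on their domain. *)
Record atlas (R : realType) (X : Type) (V : normedModType R) := Atlas {
  chart : Type ;
  dom : chart -> set X ;
  crd : chart -> X -> V }.

Section Atlas.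
Variables (R : realType) (X : Type) (V : normedModType R) (A : atlas X V).

Definition rep (W : normedModType R) (c : chart A) (f : X -> W) : V -> W :=
  in_coords (dom c) (crd c) f.

Definition atlas_open (O : set X) : Prop :=
  forall c : chart A, open (crd c @` (dom c `&` O)).

Definition smooth_fun (W : normedModType R) (O : set X) (f : X -> W) : Prop :=
  forall c : chart A, smooth_on (crd c @` (dom c `&` O)) (rep c f).

(* Derivative of f at u along the coordinate direction e of the chart c; for e
   a vector of the standard basis, a partial derivative. *)
Definition pder (W : normedModType R) (c : chart A) (f : X -> W) (e : V)
  (u : X) : W := 'D_e (rep c f) (crd c u).

(* A tangent vector at u is the family of its components in all charts around
   u, related by the differentials of the changes of coordinates; components in
   the charts not containing u are 0, so that equality is Leibniz. *)
Definition tangent (u : X) : set (chart A -> V) :=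
  [set v | (forall c c', dom c u -> dom c' u ->
              v c' = 'd (rep c (crd c')) (crd c u) (v c)) /\
           (forall c, ~ dom c u -> v c = 0)].

(* For u in dom c, the tangent vector at u whose components in c are e. *)
Definition coord_vec (c : chart A) (e : V) (u : X) : chart A -> V :=
  fun c' => if `[< dom c' u >] then 'd (rep c (crd c')) (crd c u) e else 0.

Definition smooth_vector_field (O : set X) (Y : X -> chart A -> V) : Prop :=
  (forall u, O u -> tangent u (Y u)) /\
  (forall c, smooth_on (crd c @` (dom c `&` O)) (rep c (fun u => Y u c))).

Definition smooth_distribution (H : X -> set (chart A -> V)) : Prop :=
  (forall u, linear_subspace (H u) /\ H u `<=` tangent u) /\
  (forall u, exists O : set X, [/\ atlas_open O, O u &
     exists (k : nat) (Y : 'I_k -> X -> chart A -> V),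
       (forall i, smooth_vector_field O (Y i)) /\
       (forall u', O u' -> is_basis (fun i => Y i u') (H u'))]).

(* S(H), over the open set O *)
Definition section_of (H : X -> set (chart A -> V)) (O : set X)
    (Y : X -> chart A -> V) : Prop :=
  smooth_vector_field O Y /\ forall u, O u -> H u (Y u).

End Atlas.

Arguments tangent {R X V} A u _.
Arguments coord_vec {R X V} A c e u _.

(* Differential at u of a smooth map f.  For v tangent, the result does not
   depend on the chart c used to read v. *)
Definition tangent_map (R : realType) (X Y : Type) (V W : normedModType R)
    (A : atlas X V) (B : atlas Y W) (f : X -> Y) (u : X)
    (v : chart A -> V) : chart B -> W :=
  fun d => xget 0 [set w | exists c : chart A, [/\ dom c u, dom d (f u) &
             w = 'd (rep c (fun x => crd d (f x))) (crd c u) (v c)]].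

Arguments tangent_map {R X Y V W} A B f u v _.

Definition prod_atlas (R : realType) (X Y : Type) (V W : normedModType R)
    (A : atlas X V) (B : atlas Y W) : atlas (X * Y) (V * W)%type :=
  @Atlas R (X * Y) (V * W)%type (chart A * chart B)
    (fun c => [set z | dom c.1 z.1 /\ dom c.2 z.2])
    (fun c z => (crd c.1 z.1, crd c.2 z.2)).

Section Charts.
Variables (R : realType) (X : topologicalType) (V : normedModType R).

(* phi is a homeomorphism from the open set D onto an open subset of V. *)
Definition is_chart (D : set X) (phi : X -> V) : Prop :=
  [/\ open D, set_inj D phi &
      forall U, U `<=` D -> (open U <-> open (phi @` U))].

Definition compatible (D : set X) (phi : X -> V) (D' : set X) (phi' : X -> V) :=
  smooth_on (phi @` (D `&` D')) (in_coords D phi phi') /\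
  smooth_on (phi' @` (D `&` D')) (in_coords D' phi' phi).

End Charts.

(* Smooth manifold of dimension d, with its maximal smooth atlas. *)
Record manifold (R : realType) (d : nat) := Manifold {
  carrier :> topologicalType ;
  matlas : atlas carrier 'rV[R]_d ;
  manifold_hausdorff : hausdorff_space carrier ;
  manifold_second_countable : @second_countable carrier ;
  manifold_cover : forall x, exists c : chart matlas, dom c x ;
  manifold_chart : forall c : chart matlas, is_chart (dom c) (crd c) ;
  manifold_smooth : forall c c' : chart matlas,
    compatible (dom c) (crd c) (dom c') (crd c') ;
  manifold_maximal : forall (D : set carrier) (phi : carrier -> 'rV[R]_d),
    is_chart D phi ->
    (forall c : chart matlas, compatible D phi (dom c) (crd c)) ->
    exists c : chart matlas, dom c = D /\ forall x, D x -> crd c x = phi x }.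

Section DualJet.
Variables (R : realType) (m n : nat) (T : manifold R m) (M : manifold R n).

Local Notation TA := (matlas T).
Local Notation MA := (matlas M).

(* The fibre of J^1(T, M) over (t, x): a 1-jet at t of a map phi with
   phi t = x is identified with the differential of phi at t. *)
Definition jet (t : T) (x : M)
  : set ((chart TA -> 'rV[R]_m) -> (chart MA -> 'rV[R]_n)) :=
  lin_maps (tangent TA t) (tangent MA x).

(* The total space E^* of the dual bundle. *)
Record dual_jet := DualJet {
  src : T ;
  tgt : M ;
  covec : ((chart TA -> 'rV[R]_m) -> (chart MA -> 'rV[R]_n)) -> R^o ;
  covec_hom : lin_maps (jet src tgt) [set: R^o] covec }.

Definition projE (u : dual_jet) : T * M := (src u, tgt u).

(* The 1-jet dt^a (x) d/dx^i at (t, x). *)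
Definition elem_jet (ci : chart TA) (cj : chart MA) (a : 'I_m) (i : 'I_n)
    (t : T) (x : M) (v : chart TA -> 'rV[R]_m) : chart MA -> 'rV[R]_n :=
  if `[< tangent TA t v >] then v ci ord0 a *: coord_vec MA cj (delta_mx ord0 i) x
  else 0.

Definition VE : normedModType R := ('rV[R]_m * 'rV[R]_n * 'M[R]_(m, n))%type.

(* The induced charts: p^a_i(u) is the value of u on dt^a (x) d/dx^i. *)
Definition EA : atlas dual_jet VE :=
  @Atlas R dual_jet VE (chart TA * chart MA)
    (fun c => [set u | dom c.1 (src u) /\ dom c.2 (tgt u)])
    (fun c u => (crd c.1 (src u), crd c.2 (tgt u),
       \matrix_(a < m, i < n) covec u (elem_jet c.1 c.2 a i (src u) (tgt u)))).

Definition BA : atlas (T * M) ('rV[R]_m * 'rV[R]_n)%type := prod_atlas TA MA.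

Definition tcoord (c : chart TA) (a : 'I_m) (t : T) : R^o := crd c t ord0 a.
Definition xcoord (c : chart MA) (i : 'I_n) (x : M) : R^o := crd c x ord0 i.
Definition pcoord (c : chart EA) (a : 'I_m) (i : 'I_n) (u : dual_jet) : R^o :=
  (crd c u).2 a i.

Definition dirt (a : 'I_m) : VE := (delta_mx ord0 a, 0, 0).
Definition dirx (i : 'I_n) : VE := (0, delta_mx ord0 i, 0).
Definition dirp (a : 'I_m) (i : 'I_n) : VE := (0, 0, delta_mx a i).

Definition vertical (u : dual_jet) : set (chart EA -> VE) :=
  [set v | tangent EA u v /\ tangent_map EA BA projE u v = 0].

Definition nonlinear_connection (H : dual_jet -> set (chart EA -> VE)) : Prop :=
  smooth_distribution H /\
  forall u, H u `&` vertical u = [set 0] /\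
    forall v, tangent EA u v ->
      exists h w, [/\ H u h, vertical u w & v = h + w].

(* A candidate (delta/delta t^a, delta/delta x^i) on the chart c. *)
Definition adapted (H : dual_jet -> set (chart EA -> VE)) (c : chart EA)
    (dt : 'I_m -> dual_jet -> chart EA -> VE)
    (dx : 'I_n -> dual_jet -> chart EA -> VE) : Prop :=
  [/\ forall a, section_of H (dom c) (dt a),
      forall i, section_of H (dom c) (dx i),
      forall a u, dom c u -> tangent_map EA BA projE u (dt a u) =
        coord_vec BA c (delta_mx ord0 a, 0) (projE u) &
      forall i u, dom c u -> tangent_map EA BA projE u (dx i u) =
        coord_vec BA c (0, delta_mx ord0 i) (projE u)].

Definition adapted_fields_indep (c : chart EA)
    (dt : 'I_m -> dual_jet -> chart EA -> VE)
    (dx : 'I_n -> dual_jet -> chart EA -> VE) : Prop :=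
  forall u, dom c u ->
    lin_indep (fun k : 'I_m + 'I_n =>
      match k with inl a => dt a u | inr i => dx i u end).

(* N1 b j a and N2 b j i are the coefficients with upper index b, lower
   index j in parentheses, and last lower index a, resp. i. *)
Record local_functions := LocalFunctions {
  N1 : 'I_m -> 'I_n -> 'I_m -> dual_jet -> R^o ;
  N2 : 'I_m -> 'I_n -> 'I_n -> dual_jet -> R^o }.

Definition eq_on (O : set dual_jet) (N N' : local_functions) : Prop :=
  (forall b j a u, O u -> N1 N b j a u = N1 N' b j a u) /\
  (forall b j i u, O u -> N2 N b j i u = N2 N' b j i u).

Definition smooth_functions (c : chart EA) (N : local_functions) : Prop :=
  (forall b j a, smooth_fun EA (dom c) (N1 N b j a)) /\
  (forall b j i, smooth_fun EA (dom c) (N2 N b j i)).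

Definition expressed (c : chart EA)
    (dt : 'I_m -> dual_jet -> chart EA -> VE)
    (dx : 'I_n -> dual_jet -> chart EA -> VE) (N : local_functions) : Prop :=
  (forall a u, dom c u -> dt a u = coord_vec EA c (dirt a) u -
     \sum_b \sum_j N1 N b j a u *: coord_vec EA c (dirp b j) u) /\
  (forall i u, dom c u -> dx i u = coord_vec EA c (dirx i) u -
     \sum_b \sum_j N2 N b j i u *: coord_vec EA c (dirp b j) u).

Definition coefficients_of (H : dual_jet -> set (chart EA -> VE))
    (c : chart EA) (N : local_functions) : Prop :=
  exists dt dx, adapted H c dt dx /\ expressed c dt dx N.

(* c carries the coordinates (t, x, p) and the functions N; c' carries the
   coordinates with tildes and the functions N'. *)
Definition transform_rules (c c' : chart EA) (N N' : local_functions) : Prop :=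
  forall u, dom c u -> dom c' u -> forall (b : 'I_m) (j : 'I_n),
  let dtt b c0 := pder c.1 (tcoord c'.1 b) (delta_mx ord0 c0) (src u) in
  let dxx k i := pder c.2 (xcoord c'.2 k) (delta_mx ord0 i) (tgt u) in
  let dxx' k j := pder c'.2 (xcoord c.2 k) (delta_mx ord0 j) (tgt u) in
  (forall a : 'I_m,
    \sum_e N1 N' b j e u * dtt e a =
    \sum_e \sum_k N1 N e k a u * dtt b e * dxx' k j
      - pder c (pcoord c' b j) (dirt a) u) /\
  (forall i : 'I_n,
    \sum_k N2 N' b j k u * dxx k i =
    \sum_e \sum_k N2 N e k i u * dtt b e * dxx' k j
      - pder c (pcoord c' b j) (dirx i) u).

Definition connection_functions (N : chart EA -> local_functions) : Prop :=
  (forall c, smooth_functions c (N c)) /\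
  (forall c c', transform_rules c c' (N c) (N c')).

End DualJet.

(* Main.v *)
From HB Require Import structures.
Require Import Defs.
From mathcomp Require Import all_boot all_order all_algebra.
From mathcomp Require Import all_classical all_reals all_analysis.
From mathcomp Require Import ring.

Set Implicit Arguments.
Unset Strict Implicit.
Unset Printing Implicit Defensive.

Import Order.TTheory GRing.Theory Num.Theory.
Import numFieldNormedType.Exports.

Local Open Scope classical_set_scope.
Local Open Scope ring_scope.

(** Read in an induced chart, a tangent vector of E^* is an arbitrary element of
    R^m x R^n x Mat(m, n), and the projection to T x M becomes the projection to
    the first two factors ([tangent_map_projE]), so a vector is vertical exactly
    when its base part vanishes ([verticalP]).  A nonlinear connection is
    therefore, at each point, a linear complement of the third factor, that is
    the graph of a linear map from base parts to fibre parts; minus the matrix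
    of this map is the family of coefficients N.  The adapted fields are the
    horizontal vectors whose base parts are the standard basis vectors, which
    gives their existence, uniqueness, independence and special form pointwise.

    Two points need analysis.  First, E^* must be shown to carry a smooth atlas
    ([dual_jet_smooth_atlas]): a covector is determined by its values on the
    elementary jets, and these transform by Jacobians of the base coordinates
    ([crd_transition]).  Second, the horizontal lift must depend smoothly on the
    point ([hlift_smooth]): in a local smooth basis of the distribution, the
    base parts form an invertible square matrix, and the lift is obtained by
    applying its inverse, which is smooth by Cramer's rule.

    The transformation rules say that the differential of a change of
    coordinates maps the graph in one chart into the graph in the other.
    Computing that differential ([diff_transition_t], [diff_transition_x],
    [diff_transition_p]) shows that the failure of a transformed graph vector
    (w, - N w) to lie on the other graph is linear in w, its coefficients being
    the differences of the two sides of the rules ([hvec_defect]); hence the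
    rules are equivalent to this geometric condition ([transform_rulesP]).  In
    one direction this proves the rules for a given connection; in the other, it
    shows that functions obeying the rules define a distribution which does not
    depend on the chart ([connection_ofP]), and this distribution is the only
    one with these coefficients because it is determined by its graphs
    ([horizontalP]). *)

(** * Continuous linear maps and finite-dimensional spaces *)

(** Lets the lemmas on bundled linear maps apply to a map that is only known
    to satisfy the predicate [linear]. *)
Lemma linear_pack {R : pzRingType} {V W : lmodType R} (L : V -> W) :
  linear L -> exists f : {linear V -> W}, L = f.
Proof.
move=> lL.
pose m := GRing.isLinear.Build _ _ _ _ _ lL.
pose f : {linear V -> W} := HB.pack L m.
by exists f.
Qed.

Section ContinuousLinear.
Context {R : realType} {V W : normedModType R}.

Definition clin (L : V -> W) := linear L /\ continuous L.

Lemma clin_differentiable (L : V -> W) x : clin L -> differentiable L x.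
Proof.
by move=> [/linear_pack[f ->] cf]; exact/linear_differentiable.
Qed.

Lemma clin_diff (L : V -> W) x : clin L -> 'd L x = L :> (V -> W).
Proof. by move=> [/linear_pack[f ->] cf]; exact: diff_lin. Qed.

Lemma clin_derive (L : V -> W) x v : clin L -> 'D_v L x = L v.
Proof. by move=> cL; rewrite deriveE ?clin_diff//; exact: clin_differentiable. Qed.

Lemma clin_derivecomp {U : normedModType R} (L : V -> W) (f : U -> V) x v :
  clin L -> differentiable f x -> 'D_v (L \o f) x = L ('D_v f x).
Proof.
move=> cL df; have dL := clin_differentiable (f x) cL.
rewrite (deriveE _ df) (deriveE v (differentiable_comp df dL)).
by rewrite (diff_comp df dL) /= (clin_diff (f x) cL).
Qed.

End ContinuousLinear.

Section ContinuousLinearOps.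
Context {R : realType}.
Implicit Types V W Z : normedModType R.

Lemma clin_comp V W Z (L : V -> W) (L' : W -> Z) :
  clin L -> clin L' -> clin (L' \o L).
Proof.
move=> [l c] [l' c']; split=> [a u v|x] /=; first by rewrite l l'.
by apply: continuous_comp; [exact: c|exact: c'].
Qed.

Lemma clin_fst V W : clin (fst : V * W -> V).
Proof. by split=> [a u v|x]; [|exact: cvg_fst]. Qed.

Lemma clin_snd V W : clin (snd : V * W -> W).
Proof. by split=> [a u v|x]; [|exact: cvg_snd]. Qed.

Lemma clin_id V : clin (@id V).
Proof. by split=> [a u v|x]; [|exact: cvg_id]. Qed.

Lemma clin_cst0 V W : clin (cst 0 : V -> W).
Proof. by split=> [a u v|x]; rewrite /cst /= ?scaler0 ?addr0//; exact: cvg_cst. Qed.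

Lemma clin_pair V W Z (L : V -> W) (L' : V -> Z) :
  clin L -> clin L' -> clin (fun x => (L x, L' x)).
Proof.
move=> [l c] [l' c']; split=> [a u v|x] /=; first by rewrite l l'.
by apply: cvg_pair; [exact: c|exact: c'].
Qed.

Lemma clin_scalel W (w : W) : clin (fun r : R^o => r *: w).
Proof.
split=> [a u v|x]; first by rewrite scalerDl scalerA.
exact: scalel_continuous.
Qed.

Lemma clin_coord p q (i : 'I_p) (j : 'I_q) :
  clin (fun A : 'M[R]_(p, q) => A i j : R^o).
Proof. by split=> [a u v|x]; [rewrite !mxE|exact: coord_continuous]. Qed.

End ContinuousLinearOps.

(** Continuous linear coordinates are all that is needed to expand the chain
    rule over partial derivatives; as a proposition it fixes no basis. *)
Definition findim {R : realType} (W : normedModType R) : Prop :=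
  exists (I : finType) (e : I -> W) (p : I -> W -> R^o),
    (forall i, clin (p i)) /\ forall w, w = \sum_i p i w *: e i.

Section FiniteDim.
Context {R : realType}.

Lemma findim_R : findim (R^o : normedModType R).
Proof.
exists unit, (fun=> 1), (fun=> id); split=> [_|w]; first exact: clin_id.
by rewrite (big_pred1 tt) ?scaler1// => -[].
Qed.

Lemma findim_mx p q : findim ('M[R]_(p, q) : normedModType R).
Proof.
exists ('I_p * 'I_q)%type, (fun k => delta_mx k.1 k.2), (fun k (A : 'M[R]_(p, q)) => A k.1 k.2).
split=> [[i j]|w]; first exact: clin_coord.
rewrite [LHS]matrix_sum_delta pair_big.
by apply: eq_bigr => -[].
Qed.

Lemma findim_prod (V W : normedModType R) :
  findim V -> findim W -> findim ((V * W)%type : normedModType R).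
Proof.
move=> [I [e [p [cp wp]]]] [J [e' [p' [cp' wp']]]].
exists (I + J)%type, (fun k => match k with inl i => (e i, 0) | inr j => (0, e' j) end),
  (fun k w => match k with inl i => p i w.1 | inr j => p' j w.2 end).
split=> [[i|j]|[v w]].
- exact: (clin_comp (clin_fst _ _) (cp i)).
- exact: (clin_comp (clin_snd _ _) (cp' j)).
have S1 (K : finType) (F : K -> V * W) : (\sum_k F k).1 = \sum_k (F k).1.
  by apply: (big_ind2 (fun x y => x.1 = y)) => //= x1 x2 y1 y2 <- <-.
have S2 (K : finType) (F : K -> V * W) : (\sum_k F k).2 = \sum_k (F k).2.
  by apply: (big_ind2 (fun x y => x.2 = y)) => //= x1 x2 y1 y2 <- <-.
rewrite big_sumType /=; apply: injective_projections => /=.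
  rewrite /= S1 S1 /= [X in _ + X]big1 ?addr0 -?wp// => j _.
  by rewrite scaler0.
rewrite /= S2 S2 /= [X in X + _]big1 ?add0r -?wp'// => j _.
by rewrite scaler0.
Qed.
End FiniteDim.

(** * Calculus of C^k maps *)

Section Regularity.
Context {R : realType}.
Implicit Types V W Z : normedModType R.

Lemma Ck_sub k V W (U U' : set V) (f : V -> W) :
  U `<=` U' -> Ck k U' f -> Ck k U f.
Proof.
move=> UU'; elim: k f => [|k IH] f /=; first by move=> cf x /UU'; exact: cf.
by move=> [df cf]; split=> [x /UU'|v]; [exact: df|exact: IH].
Qed.

(** The definition of [Ck] quantifies over the points of the set at every
    level separately, so regularity on a set reduces to its points. *)
Lemma Ck_pointwise k V W (U : set V) (f : V -> W) :
  (forall x, U x -> Ck k [set x] f) -> Ck k U f.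
Proof.
elim: k f => [|k IH] f /= cf; first by move=> x /cf; exact.
split=> [x /cf[+ _]|v]; first exact.
by apply: IH => x /cf[_]; exact.
Qed.

(** Differentiability is stated through a Taylor expansion with a chosen
    remainder; for a function vanishing near the point the zero map serves.
    This is what makes differentiability depend on germs only. *)
Lemma near0_differentiable V W (h : V -> W) x :
  (\near x, h x = 0) -> differentiable h x.
Proof.
move=> h0; have hx : h x = 0 by exact: nbhs_singleton h0.
have E : h \o shift x = cst (h x) + (\0 : {linear V -> W}) +o_ 0 id.
  apply/eqaddoP => _/posnumP[e].
  have : \forall y \near 0, h (y + x) = 0.
    have c : (fun y => y + x) @ (0 : V) --> x.
      by rewrite -[X in _ --> X]add0r; apply: cvgD; [exact: cvg_id|exact: cvg_cst].
    exact: c _ h0.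
  apply: filterS => y hy.
  by rewrite /= !fctE hy hx /cst /= !(addr0, subr0, oppr0) normr0 mulr_ge0.
have c0 : continuous (\0 : {linear V -> W}) by move=> y; exact: cvg_cst.
apply/diff_locallyP; rewrite (diff_unique c0 E); split; first exact: c0.
exact: E.
Qed.

Lemma near_eq_differentiable V W (f g : V -> W) x :
  (\near x, f x = g x) -> differentiable f x -> differentiable g x.
Proof.
move=> fg df; have -> : g = f + (g - f) by rewrite addrC subrK.
apply: (differentiableD df); apply: near0_differentiable.
by apply: filterS fg => y fgy; rewrite !fctE fgy subrr.
Qed.

Lemma near_eq_diff V W (f g : V -> W) x v :
  (\near x, f x = g x) -> differentiable f x -> 'd f x v = 'd g x v.
Proof.
move=> fg df; rewrite -!deriveE//; first exact: near_eq_derive.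
exact: near_eq_differentiable df.
Qed.

(** Openness matters: derivatives at a point see a whole neighbourhood. *)
Lemma eq_Ck k V W (U : set V) (f g : V -> W) :
  open U -> (forall x, U x -> f x = g x) -> Ck k U f -> Ck k U g.
Proof.
move=> oU; elim: k f g => [|k IH] f g fg.
  move=> cf x Ux; have fgx : \near x, f x = g x.
    by apply: filterS (open_nbhs_nbhs (conj oU Ux)) => y; exact: fg.
  have cfx : f @ x --> f x := cf x Ux.
  suff : g @ x --> g x by [].
  by rewrite -(fg x Ux); apply: cvg_trans cfx; exact: near_eq_cvg.
move=> [df cf]; split=> [x Ux|v].
  have fgx : \near x, f x = g x.
    by apply: filterS (open_nbhs_nbhs (conj oU Ux)) => y; exact: fg.
  exact: near_eq_differentiable fgx (df _ Ux).
apply: IH (cf v) => x Ux.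
apply: near_eq_derive.
by apply: filterS (open_nbhs_nbhs (conj oU Ux)) => y; exact: fg.
Qed.

Lemma CkW k V W (U : set V) (f : V -> W) : Ck k.+1 U f -> Ck k U f.
Proof.
elim: k f => [|k IH] f [df cf].
  by move=> x Ux; exact/differentiable_continuous/df.
by split=> // v; exact: IH.
Qed.

Lemma Ck_cst k V W (U : set V) (w : W) : Ck k U (cst w : V -> W).
Proof.
elim: k w => [|k IH] w; first by move=> x _; exact: cvg_cst.
split=> [x _|v]; first exact: differentiable_cst.
rewrite (_ : (fun x => _) = cst 0); first exact: IH.
by apply/funext => x; rewrite derive_cst.
Qed.

Lemma Ck_clin k V W (U : set V) (L : V -> W) : clin L -> Ck k U L.
Proof.
move=> cL; case: k => [|k]; first by move=> x _; exact: cL.2.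
split=> [x _|v]; first exact: clin_differentiable.
rewrite (_ : (fun x => _) = cst (L v)); first exact: Ck_cst.
by apply/funext => x; rewrite clin_derive.
Qed.

Lemma Ck_add k V W (U : set V) (f g : V -> W) : open U ->
  Ck k U f -> Ck k U g -> Ck k U (fun x => f x + g x).
Proof.
move=> oU; elim: k f g => [|k IH] f g.
  by move=> cf cg x Ux; apply: cvgD; [exact: cf|exact: cg].
move=> [df cf] [dg cg]; split=> [x Ux|v].
  by apply: differentiableD; [exact: df|exact: dg].
apply: (eq_Ck oU) (IH _ _ (cf v) (cg v)) => x Ux.
by rewrite [RHS]deriveD//; apply: diff_derivable; [exact: df|exact: dg].
Qed.

Lemma Ck_sum k V W (U : set V) (I : finType) (f : I -> V -> W) : open U ->
  (forall i, Ck k U (f i)) -> Ck k U (fun x => \sum_i f i x).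
Proof.
move=> oU cf; elim: (index_enum I) => [|i s IH].
  apply: (eq_Ck oU) (Ck_cst k U 0) => x _; by rewrite big_nil.
apply: (eq_Ck oU) (Ck_add oU (cf i) IH) => x _; by rewrite big_cons.
Qed.

Lemma Ck_clincomp k V W Z (U : set V) (L : W -> Z) (f : V -> W) :
  open U -> clin L -> Ck k U f -> Ck k U (fun x => L (f x)).
Proof.
move=> oU cL; elim: k f => [|k IH] f.
  move=> cf x Ux; apply: continuous_comp; [exact: cf|exact: cL.2].
move=> [df cf]; split=> [x Ux|v].
  by apply: differentiable_comp; [exact: df|exact: clin_differentiable].
apply: (eq_Ck oU) (IH _ (cf v)) => x Ux.
by rewrite -(clin_derivecomp v cL (df x Ux)).
Qed.

Lemma Ck_mul k V (U : set V) (f g : V -> R^o) : open U ->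
  Ck k U f -> Ck k U g -> Ck k U (fun x => f x * g x : R^o).
Proof.
move=> oU; elim: k f g => [|k IH] f g.
  by move=> cf cg x Ux; apply: cvgM; [exact: cf|exact: cg].
move=> cf' cg'; have cf := CkW cf'; have cg := CkW cg'.
case: cf' cg' => [df cdf] [dg cdg].
split=> [x Ux|v].
  by apply: differentiableM; [exact: df|exact: dg].
apply: (eq_Ck oU) (Ck_add oU (IH _ _ cf (cdg v)) (IH _ _ cg (cdf v))) => x Ux.
by rewrite [RHS]deriveM//; apply: diff_derivable; [exact: df|exact: dg].
Qed.

(** Coordinates of the target reduce this to products of scalar functions. *)
Lemma Ck_scale k V W (U : set V) (f : V -> R^o) (g : V -> W) :
  findim W -> open U ->
  Ck k U f -> Ck k U g -> Ck k U (fun x => f x *: g x).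
Proof.
move=> [I [e [p [cp wp]]]] oU cf cg.
have H : Ck k U (fun x => \sum_i (f x * p i (g x)) *: e i).
  apply: Ck_sum => // i; apply: (Ck_clincomp oU (clin_scalel (e i))).
  by apply: Ck_mul => //; exact: (Ck_clincomp oU (cp i)).
apply: (eq_Ck oU) H => x _; rewrite [in RHS](wp (g x)) scaler_sumr.
by apply: eq_bigr => i _; rewrite scalerA.
Qed.

(** Expanding the chain rule over a basis expresses the derivative of a
    composite by the partial derivatives of the outer map, which have one order
    of regularity less, so that induction applies. *)
Lemma Ck_comp k V W Z (U : set V) (U' : set W) (f : V -> W) (g : W -> Z) :
  findim W -> findim Z -> open U -> (forall x, U x -> U' (f x)) ->
  Ck k U f -> Ck k U' g -> Ck k U (fun x => g (f x)).
Proof.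
move=> [I [e [p [cp wp]]]] fZ oU UU'; elim: k g => [|k IH] g.
  move=> cf cg x Ux; apply: continuous_comp; [exact: cf|exact/cg/UU'].
move=> cf' cg'; have cf := CkW cf'; have cg := CkW cg'.
case: cf' cg' => [df cdf] [dg cdg]; split=> [x Ux|v].
  by apply: differentiable_comp; [exact: df|exact/dg/UU'].
(* The chain rule, with the derivative of f expanded over the basis e. *)
have H : Ck k U (fun x => \sum_i p i ('D_v f x) *: 'D_(e i) g (f x)).
  apply: Ck_sum => // i; apply: Ck_scale => //; last exact: (IH _ cf (cdg _)).
  exact: (Ck_clincomp oU (cp i) (cdf v)).
apply: (eq_Ck oU) H => x Ux.
have dgx := dg _ (UU' _ Ux); have dfx := df _ Ux.
rewrite (deriveE v (differentiable_comp dfx dgx)) (diff_comp dfx dgx) /=.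
rewrite -(deriveE v dfx) [in RHS](wp ('D_v f x)) linear_sum.
by apply: eq_bigr => i _; rewrite (deriveE (e i) dgx) [RHS]linearZ.
Qed.

Lemma Ck_inv k V (U : set V) (f : V -> R^o) : open U ->
  (forall x, U x -> f x != 0) -> Ck k U f -> Ck k U (fun x => (f x)^-1 : R^o).
Proof.
move=> oU f0; elim: k => [|k IH].
  by move=> cf x Ux; apply: cvgV; [exact: f0|exact: cf].
move=> cf'; have cf := IH (CkW cf'); case: cf' => [df cdf]; split=> [x Ux|v].
  by apply: differentiableV; [exact: df|exact: f0].
have H := Ck_mul oU (Ck_mul oU cf cf) (cdf v).
have {}H := Ck_mul oU (Ck_cst k U (-1 : R^o)) H.
apply: (eq_Ck oU) H => x Ux.
rewrite [RHS]deriveV//; [|exact: f0|exact/diff_derivable/df].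
by rewrite /cst mulN1r expr2 invfM scaleNr.
Qed.

End Regularity.

(** * Calculus of smooth maps *)

Section Smoothness.
Context {R : realType}.
Implicit Types V W Z : normedModType R.

Lemma smooth_differentiable V W (U : set V) (f : V -> W) x :
  smooth_on U f -> U x -> differentiable f x.
Proof. by move=> /(_ 1%N)[+ _]; exact. Qed.

Lemma smooth_derive V W (U : set V) (f : V -> W) v :
  smooth_on U f -> smooth_on U (fun x => 'D_v f x).
Proof. by move=> sf k; have [_] := sf k.+1; exact. Qed.

Lemma smooth_sub V W (U U' : set V) (f : V -> W) :
  U `<=` U' -> smooth_on U' f -> smooth_on U f.
Proof. by move=> UU' sf k; exact: Ck_sub (sf k). Qed.

Lemma smooth_local V W (U : set V) (f : V -> W) :
  (forall x, U x -> exists2 U', U' x & smooth_on U' f) -> smooth_on U f.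
Proof.
move=> sf k; apply: Ck_pointwise => x /sf[U' U'x sU'].
by apply: Ck_sub (sU' k) => _ ->.
Qed.

Lemma eq_smooth V W (U : set V) (f g : V -> W) :
  open U -> (forall x, U x -> f x = g x) -> smooth_on U f -> smooth_on U g.
Proof. by move=> oU fg sf k; exact: eq_Ck (sf k). Qed.

Lemma smooth_cst V W (U : set V) (w : W) : smooth_on U (cst w : V -> W).
Proof. by move=> k; exact: Ck_cst. Qed.

Lemma smooth_clin V W (U : set V) (L : V -> W) : clin L -> smooth_on U L.
Proof. by move=> cL k; exact: Ck_clin. Qed.

Lemma smooth_clincomp V W Z (U : set V) (L : W -> Z) (f : V -> W) :
  open U -> clin L -> smooth_on U f -> smooth_on U (fun x => L (f x)).
Proof. by move=> oU cL sf k; exact: Ck_clincomp. Qed.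

Lemma smooth_add V W (U : set V) (f g : V -> W) : open U ->
  smooth_on U f -> smooth_on U g -> smooth_on U (fun x => f x + g x).
Proof. by move=> oU sf sg k; exact: Ck_add. Qed.

Lemma smooth_sum V W (U : set V) (I : finType) (f : I -> V -> W) : open U ->
  (forall i, smooth_on U (f i)) -> smooth_on U (fun x => \sum_i f i x).
Proof. by move=> oU sf k; apply: Ck_sum => // i; exact: sf. Qed.

Lemma smooth_mul V (U : set V) (f g : V -> R^o) : open U ->
  smooth_on U f -> smooth_on U g -> smooth_on U (fun x => f x * g x : R^o).
Proof. by move=> oU sf sg k; exact: Ck_mul. Qed.

Lemma smooth_scale V W (U : set V) (f : V -> R^o) (g : V -> W) :
  findim W -> open U ->
  smooth_on U f -> smooth_on U g -> smooth_on U (fun x => f x *: g x).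
Proof. by move=> fW oU sf sg k; exact: Ck_scale. Qed.

Lemma smooth_comp V W Z (U : set V) (U' : set W) (f : V -> W) (g : W -> Z) :
  findim W -> findim Z -> open U -> (forall x, U x -> U' (f x)) ->
  smooth_on U f -> smooth_on U' g -> smooth_on U (fun x => g (f x)).
Proof. by move=> fW fZ oU UU' sf sg k; exact: Ck_comp (sf k) (sg k). Qed.

Lemma smooth_inv V (U : set V) (f : V -> R^o) : open U ->
  (forall x, U x -> f x != 0) -> smooth_on U f ->
  smooth_on U (fun x => (f x)^-1 : R^o).
Proof. by move=> oU f0 sf k; exact: Ck_inv. Qed.

Lemma smooth_opp V W (U : set V) (f : V -> W) : open U ->
  smooth_on U f -> smooth_on U (fun x => - f x).
Proof.
move=> oU sf; apply: (smooth_clincomp oU _ sf).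
by split=> [a u v|x]; [rewrite scalerN opprD|exact: cvgN].
Qed.

Lemma smooth_pair V W Z (U : set V) (f : V -> W) (g : V -> Z) : open U ->
  smooth_on U f -> smooth_on U g -> smooth_on U (fun x => (f x, g x)).
Proof.
move=> oU sf sg.
have sf' := smooth_clincomp oU (clin_pair (clin_id _) (clin_cst0 W Z)) sf.
have sg' := smooth_clincomp oU (clin_pair (clin_cst0 Z W) (clin_id _)) sg.
apply: (eq_smooth oU) (smooth_add oU sf' sg') => x _.
by apply: injective_projections; rewrite /= /cst ?addr0 ?add0r.
Qed.

Lemma smooth_prod V (U : set V) (I : finType) (f : I -> V -> R^o) : open U ->
  (forall i, smooth_on U (f i)) -> smooth_on U (fun x => \prod_i f i x : R^o).
Proof.
move=> oU sf; elim: (index_enum I) => [|i s IH].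
  apply: (eq_smooth oU) (smooth_cst U (1 : R^o)) => x _; by rewrite big_nil.
apply: (eq_smooth oU) (smooth_mul oU (sf i) IH) => x _; by rewrite big_cons.
Qed.

Lemma smooth_mx V p q (U : set V) (A : V -> 'M[R]_(p, q)) : open U ->
  (forall i j, smooth_on U (fun x => A x i j : R^o)) -> smooth_on U A.
Proof.
move=> oU sA.
have H : smooth_on U (fun x => \sum_i \sum_j (A x i j : R^o) *: delta_mx i j : 'M[R]_(p, q)).
  do 2!apply: smooth_sum => // ?.
  exact: (smooth_clincomp oU (clin_scalel _) (sA _ _)).
by apply: (eq_smooth oU) H => x _; rewrite -matrix_sum_delta.
Qed.

Lemma smooth_entry V p q (U : set V) (A : V -> 'M[R]_(p, q)) i j : open U ->
  smooth_on U A -> smooth_on U (fun x => A x i j : R^o).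
Proof. by move=> oU; exact: (smooth_clincomp oU (clin_coord i j)). Qed.

Lemma smooth_det V p (U : set V) (A : V -> 'M[R]_p) : open U ->
  smooth_on U A -> smooth_on U (fun x => \det (A x) : R^o).
Proof.
move=> oU sA; apply: smooth_sum => // s; apply: smooth_mul => //.
  exact: smooth_cst.
by apply: smooth_prod => // i; exact: smooth_entry.
Qed.

(** Cramer's rule: the inverse is the adjugate divided by the determinant,
    both polynomial in the entries. *)
Lemma smooth_invmx V p (U : set V) (A : V -> 'M[R]_p) : open U ->
  (forall x, U x -> A x \in unitmx) ->
  smooth_on U A -> smooth_on U (fun x => invmx (A x)).
Proof.
move=> oU uA sA.
have sadj : smooth_on U (fun x => \adj (A x)).
  apply: smooth_mx => // i j.
  have H : smooth_on U (fun x => (-1) ^+ (j + i) * \det (row' j (col' i (A x))) : R^o).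
    apply: smooth_mul => //; first exact: smooth_cst.
    apply: smooth_det => //; apply: smooth_mx => // k l.
    apply: (eq_smooth oU) (smooth_entry (lift j k) (lift i l) oU sA) => x _.
    by rewrite !mxE.
  by apply: (eq_smooth oU) H => x _; rewrite mxE.
have H : smooth_on U (fun x => (\det (A x))^-1 *: \adj (A x)).
  apply: smooth_scale => //; first exact: findim_mx.
  apply: smooth_inv => //; last exact: smooth_det.
  by move=> x /uA; rewrite unitmxE unitfE.
by apply: (eq_smooth oU) H => x /uA uAx; rewrite /invmx uAx.
Qed.

Lemma smooth_mulmx V p q r (U : set V) (A : V -> 'M[R]_(p, q))
  (B : V -> 'M[R]_(q, r)) : open U ->
  smooth_on U A -> smooth_on U B -> smooth_on U (fun x => A x *m B x).
Proof.
move=> oU sA sB; apply: smooth_mx => // i j.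
have H : smooth_on U (fun x => \sum_k A x i k * B x k j : R^o).
  by apply: smooth_sum => // k; apply: smooth_mul => //; exact: smooth_entry.
by apply: (eq_smooth oU) H => x _; rewrite mxE.
Qed.

End Smoothness.

(** * Smooth atlases and their tangent vectors *)

Section SmoothAtlas.
Context {R : realType} {X : Type} {V : normedModType R}.

(** The part of the theory of manifolds that tangent vectors and smooth
    fields rely on; it makes sense without a topology on the underlying set, as
    for the total space of the dual jet bundle. *)
Record smooth_atlas (A : atlas X V) : Prop := SmoothAtlas {
  atlas_inj : forall c : chart A, set_inj (dom c) (crd c) ;
  atlas_overlap : forall c c' : chart A, open (crd c @` (dom c `&` dom c')) ;
  atlas_transition : forall c c' : chart A,
    smooth_on (crd c @` (dom c `&` dom c')) (rep c (crd c')) ;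
  atlas_findim : findim V }.

Context {A : atlas X V} (sA : smooth_atlas A).
Implicit Types (c : chart A) (u : X) (O : set X).

Lemma rep_crd {W : normedModType R} c (f : X -> W) u :
  dom c u -> rep c f (crd c u) = f u.
Proof.
move=> cu; apply: xget_unique; first by exists u.
move=> w [u' [cu' uu' <-]]; congr f.
by apply: (atlas_inj sA (c := c)) uu'; rewrite ?inE.
Qed.

Lemma atlas_open_dom c : atlas_open A (dom c).
Proof. by move=> c'; exact: atlas_overlap. Qed.

Lemma atlas_openI O O' : atlas_open A O -> atlas_open A O' ->
  atlas_open A (O `&` O').
Proof.
move=> oO oO' c.
rewrite (_ : _ @` _ = crd c @` (dom c `&` O) `&` crd c @` (dom c `&` O')).
  exact: openI.
apply/seteqP; split=> [_ [u [cu [Ou O'u]] <-]|y [[u [cu Ou] <-]]].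
  by split; exists u.
move=> [u' [cu' O'u']] uu'; exists u => //; split=> //; split=> //.
by rewrite -(atlas_inj sA _ _ uu')// inE.
Qed.

Lemma near_chart O c u (P : V -> Prop) : atlas_open A O -> dom c u -> O u ->
  (forall u', dom c u' -> O u' -> P (crd c u')) -> \forall y \near crd c u, P y.
Proof.
move=> oO cu Ou OP.
have Uu : (crd c @` (dom c `&` O)) (crd c u) by exists u.
by apply: filterS (open_nbhs_nbhs (conj (oO c) Uu)) => _ [u' [cu' Ou'] <-]; exact: OP.
Qed.

Lemma transition_differentiable c c' u : dom c u -> dom c' u ->
  differentiable (rep c (crd c')) (crd c u).
Proof.
move=> cu c'u; apply: (smooth_differentiable (atlas_transition sA c c')).
by exists u.
Qed.

Lemma near_rep_change {W : normedModType R} c c' u (f : X -> W) :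
  dom c u -> dom c' u ->
  \forall y \near crd c u, (rep c' f \o rep c (crd c')) y = rep c f y.
Proof.
move=> cu c'u; apply: (near_chart (atlas_open_dom c') cu c'u) => u' cu' c'u' /=.
by rewrite (rep_crd (crd c') cu') !rep_crd.
Qed.

(** Chain rule for the local representatives of one map in two charts. *)
Lemma rep_diff_change {W : normedModType R} c c' u (f : X -> W) v :
  dom c u -> dom c' u -> differentiable (rep c' f) (crd c' u) ->
  'd (rep c f) (crd c u) v =
  'd (rep c' f) (crd c' u) ('d (rep c (crd c')) (crd c u) v).
Proof.
move=> cu c'u df; have dt := transition_differentiable cu c'u.
have {}df : differentiable (rep c' f) (rep c (crd c') (crd c u)).
  by rewrite (rep_crd (crd c') cu).
rewrite -(near_eq_diff v (near_rep_change f cu c'u) (differentiable_comp dt df)).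
by rewrite (diff_comp dt df) /= (rep_crd (crd c') cu).
Qed.

Lemma diff_transition_id c u v : dom c u ->
  'd (rep c (crd c)) (crd c u) v = v.
Proof.
move=> cu.
have E : \forall y \near crd c u, rep c (crd c) y = id y.
  by apply: (near_chart (atlas_open_dom c) cu cu) => u' cu' _; exact: rep_crd.
by rewrite (near_eq_diff v E (transition_differentiable cu cu)) (clin_diff _ (clin_id V)).
Qed.

Lemma coord_vecE c c' e u : dom c' u ->
  coord_vec A c e u c' = 'd (rep c (crd c')) (crd c u) e.
Proof. by move=> c'u; rewrite /coord_vec asboolT. Qed.

Lemma coord_vecN c c' e u : ~ dom c' u -> coord_vec A c e u c' = 0.
Proof. by move=> c'u; rewrite /coord_vec asboolF. Qed.

Lemma coord_vec_linear c u : linear (fun e => coord_vec A c e u).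
Proof.
move=> a e e'; apply/funext => c'; have [c'u|c'u] := pselect (dom c' u).
  transitivity (a *: coord_vec A c e u c' + coord_vec A c e' u c') => //.
  by rewrite !coord_vecE// linearP.
transitivity (a *: coord_vec A c e u c' + coord_vec A c e' u c') => //.
by rewrite !coord_vecN// scaler0 addr0.
Qed.

Lemma coord_vec_self c e u : dom c u -> coord_vec A c e u c = e.
Proof. by move=> cu; rewrite coord_vecE// diff_transition_id. Qed.

Lemma coord_vec_tangent c e u : dom c u -> tangent A u (coord_vec A c e u).
Proof.
move=> cu; split=> [c1 c2 c1u c2u|c' /coord_vecN //].
rewrite !coord_vecE//; apply: rep_diff_change => //.
exact: transition_differentiable.
Qed.

Lemma tangent_coord_vec c u v : dom c u -> tangent A u v ->
  v = coord_vec A c (v c) u.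
Proof.
move=> cu [tv v0]; apply/funext => c'; have [c'u|c'u] := pselect (dom c' u).
  by rewrite coord_vecE// (tv c c').
by rewrite coord_vecN// v0.
Qed.

Lemma tangent_eq c u v w : dom c u -> tangent A u v -> tangent A u w ->
  v c = w c -> v = w.
Proof.
move=> cu tv tw vw.
by rewrite (tangent_coord_vec cu tv) (tangent_coord_vec cu tw) vw.
Qed.

Lemma tangent_linear u : linear_subspace (tangent A u).
Proof.
split=> [|a v w [tv v0] [tw w0]].
  by split=> // c c' _ _; rewrite [RHS]linear0.
split=> [c c' cu c'u|c cu]; rewrite !fctE.
  by rewrite linearP (tv c c')// (tw c c').
by rewrite v0// w0// scaler0 addr0.
Qed.

Lemma tangent_sum (I : finType) (a : I -> R) (v : I -> chart A -> V) u :
  (forall i, tangent A u (v i)) -> tangent A u (\sum_i a i *: v i).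
Proof.
move=> tv; have [t0 tl] := tangent_linear u.
elim: (index_enum I) => [|i s IH]; first by rewrite big_nil.
by rewrite big_cons; exact: tl.
Qed.

(** Smoothness read in one chart gives smoothness in every chart, because
    the two readings differ by a smooth transition map. *)
Lemma smooth_rep_change {W : normedModType R} c c' O (f : X -> W) :
  findim W -> atlas_open A O ->
  smooth_on (crd c @` (dom c `&` O)) (rep c f) ->
  smooth_on (crd c' @` (dom c' `&` (dom c `&` O))) (rep c' f).
Proof.
move=> fW oO sf; have oI := atlas_openI (atlas_open_dom c) oO.
have st : smooth_on (crd c' @` (dom c' `&` (dom c `&` O))) (rep c' (crd c)).
  apply: smooth_sub (atlas_transition sA c' c).
  by move=> _ [u [c'u [cu _]] <-]; exists u.
apply: (eq_smooth (oI c') _ (smooth_comp (atlas_findim sA) fW (oI c') _ st sf)).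
  by move=> _ [u [c'u [cu Ou]] <-]; rewrite (rep_crd (crd c) c'u) !rep_crd.
by move=> _ [u [c'u [cu Ou]] <-]; rewrite (rep_crd (crd c) c'u); exists u.
Qed.

(** The components in another chart are obtained by applying the
    differential of the transition map; expanded over a basis they are sums of
    products of smooth functions. *)
Lemma smooth_vector_field_chart c O (Y : X -> chart A -> V) :
  atlas_open A O -> O `<=` dom c -> (forall u, O u -> tangent A u (Y u)) ->
  smooth_on (crd c @` (dom c `&` O)) (rep c (fun u => Y u c)) ->
  smooth_vector_field O Y.
Proof.
move=> oO Oc tY sY; split=> // c'.
have fV := atlas_findim sA; have [I [e [p [cp wp]]]] := fV.
have oO' := atlas_openI oO (atlas_open_dom c').
(* The components in c' as a function of the coordinates of c. *)
pose g (y : V) : V := \sum_i p i (rep c (fun u => Y u c) y) *: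
  'D_(e i) (rep c (crd c')) y.
have sg : smooth_on (crd c @` (dom c `&` (O `&` dom c'))) g.
  apply: smooth_sum => // i; apply: smooth_scale => //.
    apply: smooth_clincomp => //; apply: smooth_sub sY.
    by move=> _ [u [cu [Ou _]] <-]; exists u.
  apply: smooth_derive; apply: smooth_sub (atlas_transition sA c c').
  by move=> _ [u [cu [_ c'u]] <-]; exists u.
have st : smooth_on (crd c' @` (dom c' `&` O)) (rep c' (crd c)).
  apply: smooth_sub (atlas_transition sA c' c).
  by move=> _ [u [c'u Ou] <-]; exists u => //; split=> //; exact: Oc.
apply: (eq_smooth (oO c') _ (smooth_comp fV fV (oO c') _ st sg)).
  move=> _ [u [c'u Ou] <-]; have cu := Oc _ Ou.
  rewrite (rep_crd (crd c) c'u) (rep_crd (fun u => Y u c') c'u) /g.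
  rewrite (rep_crd (fun u => Y u c) cu) ((tY u Ou).1 c c' cu c'u).
  rewrite [in RHS](wp (Y u c)) linear_sum; apply: eq_bigr => i _.
  by rewrite (deriveE _ (transition_differentiable cu c'u)) [RHS]linearZ.
move=> _ [u [c'u Ou] <-]; rewrite (rep_crd (crd c) c'u).
by exists u => //; split=> //; exact: Oc.
Qed.

End SmoothAtlas.

Lemma open_setX {S T : topologicalType} (U : set S) (U' : set T) :
  open U -> open U' -> open (U `*` U').
Proof.
move=> oU oU'.
have -> : U `*` U' = fst @^-1` U `&` snd @^-1` U' by [].
apply: openI; apply: open_comp => // x _; [exact: cvg_fst|exact: cvg_snd].
Qed.

Section ProductAtlas.
Context {R : realType} {X Y : Type} {V W : normedModType R}.
Context {A : atlas X V} {B : atlas Y W}.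

Lemma prod_smooth_atlas :
  smooth_atlas A -> smooth_atlas B -> smooth_atlas (prod_atlas A B).
Proof.
move=> sA sB.
have E (c c' : chart (prod_atlas A B)) : crd c @` (dom c `&` dom c') =
    (crd c.1 @` (dom c.1 `&` dom c'.1)) `*` (crd c.2 @` (dom c.2 `&` dom c'.2)).
  apply/seteqP; split=> [_ [[x y] /= [[cx cy] [c'x c'y]] <-]|].
    by split; [exists x|exists y].
  by move=> [_ _] [/= [x [cx c'x] <-] [y [cy c'y] <-]]; exists (x, y).
split=> [c|c c'|c c'|].
- move=> [x y] [x' y']; rewrite !inE => /= -[cx cy] [cx' cy'] [].
  by move=> /(atlas_inj sA) -> //=; rewrite ?inE// => /(atlas_inj sB) -> //; rewrite inE.
- by rewrite E; apply: open_setX; exact: atlas_overlap.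
- have oE : open (crd c @` (dom c `&` dom c')).
    by rewrite E; apply: open_setX; exact: atlas_overlap.
  have s1 : smooth_on (crd c @` (dom c `&` dom c')) (fun y => rep c.1 (crd c'.1) y.1).
    apply: (smooth_comp (atlas_findim sA) (atlas_findim sA) oE _ _ (atlas_transition sA c.1 c'.1)).
      by rewrite E => y [].
    exact/smooth_clin/clin_fst.
  have s2 : smooth_on (crd c @` (dom c `&` dom c')) (fun y => rep c.2 (crd c'.2) y.2).
    apply: (smooth_comp (atlas_findim sB) (atlas_findim sB) oE _ _ (atlas_transition sB c.2 c'.2)).
      by rewrite E => y [].
    exact/smooth_clin/clin_snd.
  apply: (eq_smooth oE) (smooth_pair oE s1 s2) => _ [[x y] [/= [cx cy] [c'x c'y]] <-].
  rewrite (rep_crd sA _ cx) (rep_crd sB _ cy); symmetry.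
  apply: xget_unique; first by exists (x, y).
  move=> w [[x' y'] [/= [cx' cy'] [xx' yy'] <-]].
  by rewrite (atlas_inj sA _ _ xx') ?inE// (atlas_inj sB _ _ yy') ?inE.
- exact: findim_prod (atlas_findim sA) (atlas_findim sB).
Qed.

End ProductAtlas.

Lemma manifold_smooth_atlas {R : realType} {d : nat} (M : manifold R d) :
  smooth_atlas (matlas M).
Proof.
split=> [c|c c'|c c'|]; last exact: findim_mx.
- by have [] := manifold_chart c.
- have [oc _ H] := manifold_chart c; have [oc' _ _] := manifold_chart c'.
  by apply/H; [exact: subIsetl|exact: openI].
- by have [] := manifold_smooth c c'.
Qed.

(** * Fibre coordinates on the dual jet bundle *)

Section LinMaps.
Context {R : realType} {E F : lmodType R}.
Implicit Types (S : set E) (f : E -> F).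

Lemma subspace_sum S (I : finType) (a : I -> R) (v : I -> E) :
  linear_subspace S -> (forall i, S (v i)) -> S (\sum_i a i *: v i).
Proof.
move=> [S0 SP] Sv; elim: (index_enum I) => [|i s IH]; first by rewrite big_nil.
by rewrite big_cons; exact: SP.
Qed.

Lemma lin_maps0 S (S' : set F) f : linear_subspace S -> lin_maps S S' f -> f 0 = 0.
Proof.
move=> [S0 _] [_ fP _]; have := fP 1 _ _ S0 S0.
by rewrite !scale1r addr0 -[LHS]addr0 => /addrI.
Qed.

Lemma lin_maps_sum S (S' : set F) f (I : finType) (a : I -> R) (v : I -> E) :
  linear_subspace S -> lin_maps S S' f -> (forall i, S (v i)) ->
  f (\sum_i a i *: v i) = \sum_i a i *: f (v i).
Proof.
move=> lS lf Sv; have [_ fP _] := lf; have [S0 SP] := lS.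
suff [] : S (\sum_i a i *: v i) /\ f (\sum_i a i *: v i) = \sum_i a i *: f (v i) by [].
elim: (index_enum I) => [|i s [IH1 IH2]].
  by rewrite !big_nil (lin_maps0 lS lf).
by rewrite !big_cons; split; [exact: SP|rewrite fP// IH2].
Qed.

Lemma lin_maps_subspace S (S' : set F) :
  linear_subspace S' -> linear_subspace (lin_maps S S').
Proof.
move=> [S0 SP]; split=> [|a f g [fS fP f0] [gS gP g0]].
  by split=> // *; rewrite scaler0 addr0.
split=> [v Sv|b v w Sv Sw|v Sv].
- by apply: SP; [exact: fS|exact: gS].
- change (a *: f (b *: v + w) + g (b *: v + w) =
    b *: (a *: f v + g v) + (a *: f w + g w)).
  rewrite fP// gP// !scalerDr !scalerA (mulrC a b) -!addrA; congr (_ + _).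
  by rewrite addrCA.
- by change (a *: f v + g v = 0); rewrite f0// g0// scaler0 addr0.
Qed.

End LinMaps.

Section DualJetAtlas.
Context {R : realType} {m n : nat} {T : manifold R m} {M : manifold R n}.

Local Notation TA := (matlas T).
Local Notation MA := (matlas M).
Local Notation EA := (EA T M).
Local Notation BA := (BA T M).
Implicit Types (c d : chart EA) (u : dual_jet T M).

Let sT : smooth_atlas TA := manifold_smooth_atlas T.
Let sM : smooth_atlas MA := manifold_smooth_atlas M.

Lemma base_smooth_atlas : smooth_atlas BA.
Proof. exact: prod_smooth_atlas. Qed.

Lemma elem_jet_jet (ci : chart TA) (cj : chart MA) a i t x :
  dom cj x -> jet t x (elem_jet ci cj a i t x).
Proof.
move=> cx; have [T0 TP] := tangent_linear (A := TA) t.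
have [M0 MP] := tangent_linear (A := MA) x.
split=> [v tv|b v w tv tw|v tv]; rewrite /elem_jet.
- rewrite asboolT// -[X in _ _ X]addr0; apply: MP => //.
  exact: coord_vec_tangent.
- rewrite !asboolT//; last exact: TP.
  rewrite [(_ + _) ci]/= scalerA -scalerDl; congr (_ *: _).
  by rewrite [(b *: v + w) ci](_ : _ = b *: v ci + w ci)// !mxE.
- by rewrite asboolF.
Qed.

Lemma rowv_sum_delta p (w : 'rV[R]_p) : w = \sum_i w ord0 i *: delta_mx ord0 i.
Proof. exact: row_sum_delta. Qed.


(** The jets dt^a (x) d/dx^i span the fibre of the jet bundle; the
    coefficients are the entries of the jet as a linear map. *)
Lemma jet_decomposition (ci : chart TA) (cj : chart MA) t x F :
  dom ci t -> dom cj x -> jet t x F ->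
  F = \sum_k F (coord_vec TA ci (delta_mx ord0 k.1) t) cj ord0 k.2 *:
        elem_jet ci cj k.1 k.2 t x.
Proof.
move=> ct cx jF; have [FT FP F0] := jF.
apply/funext => v; rewrite fct_sumE.
have [tv|tv] := pselect (tangent TA t v); last first.
  rewrite F0// big1// => k _.
  change (F (coord_vec TA ci (delta_mx ord0 k.1) t) cj ord0 k.2 *:
    elem_jet ci cj k.1 k.2 t x v = 0).
  by rewrite /elem_jet asboolF// scaler0.
have tc a : tangent TA t (coord_vec TA ci (delta_mx ord0 a) t).
  exact: coord_vec_tangent.
have ve : v = \sum_a v ci ord0 a *: coord_vec TA ci (delta_mx ord0 a) t.
  apply: (tangent_eq ct tv); first exact: tangent_sum.
  rewrite fct_sumE [LHS]rowv_sum_delta; apply: eq_bigr => a _.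
  change (v ci ord0 a *: delta_mx ord0 a =
    v ci ord0 a *: (coord_vec TA ci (delta_mx ord0 a) t ci)).
  by rewrite coord_vec_self.
apply: (tangent_eq cx); first exact: FT.
  apply: (@tangent_sum _ _ _ MA _
    (fun k => F (coord_vec TA ci (delta_mx ord0 k.1) t) cj ord0 k.2)
    (fun k => elem_jet ci cj k.1 k.2 t x v)) => k.
  by have [+ _ _] := elem_jet_jet ci k.1 k.2 t cx; exact.
rewrite {1}ve (lin_maps_sum _ (tangent_linear t) jF)// !fct_sumE.
rewrite -(pair_bigA _ (fun a i => (F (coord_vec TA ci (delta_mx ord0 a) t) cj ord0 i *:
        elem_jet ci cj a i t x) v cj)) /=; apply: eq_bigr => a _.
change (v ci ord0 a *: F (coord_vec TA ci (delta_mx ord0 a) t) cj =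
  \sum_i F (coord_vec TA ci (delta_mx ord0 a) t) cj ord0 i *: elem_jet ci cj a i t x v cj).
rewrite {1}(rowv_sum_delta (F (coord_vec TA ci (delta_mx ord0 a) t) cj)) scaler_sumr.
apply: eq_bigr => i _; rewrite /elem_jet asboolT//.
change (v ci ord0 a *: (F (coord_vec TA ci (delta_mx ord0 a) t) cj ord0 i *: delta_mx ord0 i) =
  F (coord_vec TA ci (delta_mx ord0 a) t) cj ord0 i *:
   (v ci ord0 a *: coord_vec MA cj (delta_mx ord0 i) x cj)).
by rewrite coord_vec_self// !scalerA mulrC.
Qed.

Lemma covec_chart c u F : dom c u -> jet (src u) (tgt u) F ->
  covec u F = \sum_k F (coord_vec TA c.1 (delta_mx ord0 k.1) (src u)) c.2 ord0 k.2 *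
    (crd c u).2 k.1 k.2.
Proof.
move=> [cu1 cu2] jF; rewrite {1}(jet_decomposition cu1 cu2 jF).
have jS := lin_maps_subspace (tangent TA (src u)) (tangent_linear (A := MA) (tgt u)).
rewrite (lin_maps_sum _ jS (covec_hom u)); last by move=> k; exact: elem_jet_jet.
by apply: eq_bigr => k _; rewrite /= mxE.
Qed.

Lemma dual_jet_eq u u' : src u = src u' -> tgt u = tgt u' ->
  (forall F, jet (src u) (tgt u) F -> covec u F = covec u' F) -> u = u'.
Proof.
case: u u' => [t x f hf] [t' x' f' hf'] /= tt xx; subst t' x' => ff.
have {}ff : f = f'.
  apply/funext => F; have [jF|jF] := pselect (jet t x F); first exact: ff.
  by have [_ _ ->] := hf => //; have [_ _ ->] := hf'.
by subst f'; congr DualJet; exact: Prop_irrelevance.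
Qed.

(** Every matrix is the fibre coordinate of some covector, so the image of
    an induced chart is a full cylinder over the image of the base charts. *)
Lemma crd_surjective c t x (p : 'M[R]_(m, n)) : dom c.1 t -> dom c.2 x ->
  exists2 u, src u = t /\ tgt u = x & crd c u = (crd c.1 t, crd c.2 x, p).
Proof.
move=> ct cx.
pose g (F : (chart TA -> 'rV[R]_m) -> chart MA -> 'rV[R]_n) : R^o :=
  if `[< jet t x F >] then
    \sum_k F (coord_vec TA c.1 (delta_mx ord0 k.1) t) c.2 ord0 k.2 * p k.1 k.2
  else 0.
have [J0 JP] := lin_maps_subspace (tangent TA t) (tangent_linear (A := MA) x).
have hg : lin_maps (jet t x) [set: R^o] g.
  split=> // [a F G jF jG|F jF]; rewrite /g; last by rewrite asboolF.
  rewrite !asboolT//; last exact: JP.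
  rewrite scaler_sumr -big_split; apply: eq_bigr => k _ /=.
  set v := coord_vec _ _ _ _.
  rewrite [(a *: F + G) v c.2](_ : _ = a *: F v c.2 + G v c.2)// !mxE.
  by rewrite mulrDl -mulrA.
exists (DualJet hg) => //; congr (_, _, _); apply/matrixP => b j; rewrite mxE /= /g.
rewrite asboolT; last exact: elem_jet_jet.
rewrite (bigD1 (b, j))//= big1 ?addr0 => [|[a i] ai].
  rewrite /elem_jet asboolT; last exact: coord_vec_tangent.
  rewrite [X in X * _](_ : _ = (coord_vec TA c.1 (delta_mx ord0 b) t c.1 ord0 b *:
    coord_vec MA c.2 (delta_mx ord0 j) x c.2) ord0 j)//.
  by rewrite !coord_vec_self// !mxE !eqxx !mul1r.
rewrite /elem_jet asboolT; last exact: coord_vec_tangent.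
rewrite [X in X * _](_ : _ = (coord_vec TA c.1 (delta_mx ord0 a) t c.1 ord0 b *:
    coord_vec MA c.2 (delta_mx ord0 j) x c.2) ord0 i)//.
rewrite !coord_vec_self// !mxE !eqxx /=.
move: ai; rewrite xpair_eqE negb_and (eq_sym a b) (eq_sym i j) => /orP[]/negPf ->.
  by rewrite !mul0r.
by rewrite mulr0 mul0r.
Qed.

End DualJetAtlas.

(** * The dual jet bundle as a smooth bundle over the base *)

Section PartialDerivatives.
Context {R : realType} {X : Type} {V : normedModType R} {A : atlas X V}.
Context (sA : smooth_atlas A).

Lemma pder_clin {W Z : normedModType R} (c : chart A) (f : X -> W) (L : W -> Z)
  e u : clin L -> dom c u -> differentiable (rep c f) (crd c u) ->
  pder c (fun x => L (f x)) e u = L ('d (rep c f) (crd c u) e).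
Proof.
move=> cL cu df; rewrite -(deriveE e df) -(clin_derivecomp e cL df).
apply: near_eq_derive; apply: (near_chart (atlas_open_dom sA c) cu cu) => u' cu' _.
by rewrite /= !(rep_crd sA _ cu').
Qed.

End PartialDerivatives.

Section ManifoldJacobian.
Context {R : realType} {d : nat} {X : manifold R d}.
Implicit Types (c : chart (matlas X)).

Let sX : smooth_atlas (matlas X) := manifold_smooth_atlas X.

(** Jacobian entries as functions of the coordinates, for use in statements
    about smoothness. *)
Definition jac c c' (y : 'rV[R]_d) (b e : 'I_d) : R^o :=
  ('D_(delta_mx ord0 e) (rep c (crd c')) y : 'rV[R]_d) ord0 b.

Lemma pder_coord c c' x b e : dom c x -> dom c' x ->
  pder c (fun x => crd c' x ord0 b : R^o) (delta_mx ord0 e) x =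
  jac c c' (crd c x) b e.
Proof.
move=> cx c'x; have dx := transition_differentiable sX cx c'x.
rewrite /jac (deriveE _ dx).
exact: (pder_clin sX (delta_mx ord0 e) (clin_coord ord0 b) cx dx).
Qed.

Lemma diff_pder c c' x w b : dom c x -> dom c' x ->
  ('d (rep c (crd c')) (crd c x) w) ord0 b =
  \sum_a pder c (fun x => crd c' x ord0 b : R^o) (delta_mx ord0 a) x * w ord0 a.
Proof.
move=> cx c'x; have dx := transition_differentiable sX cx c'x.
rewrite {1}(rowv_sum_delta w) linear_sum summxE; apply: eq_bigr => a _.
by rewrite linearZ /= mxE mulrC (pder_coord b a cx c'x) /jac (deriveE _ dx).
Qed.

End ManifoldJacobian.

Section DualJetTransition.
Context {R : realType} {m n : nat} {T : manifold R m} {M : manifold R n}.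

Local Notation TA := (matlas T).
Local Notation MA := (matlas M).
Local Notation EA := (EA T M).
Local Notation BA := (BA T M).
Implicit Types (c d : chart EA) (u : dual_jet T M).

Let sT : smooth_atlas TA := manifold_smooth_atlas T.
Let sM : smooth_atlas MA := manifold_smooth_atlas M.

Definition fibre_transition c c' (y : VE R m n) : 'M[R]_(m, n) :=
  \matrix_(b, j) \sum_e \sum_k (jac c.1 c'.1 y.1.1 b e *
    jac c'.2 c.2 (rep c.2 (crd c'.2) y.1.2) k j) * y.2 e k.

(** The change of induced coordinates as an explicit formula on the whole
    coordinate space; it agrees with the abstract one on overlaps, and its
    smoothness and partial derivatives can be read off. *)
Definition bundle_transition c c' (y : VE R m n) : VE R m n :=
  (rep c.1 (crd c'.1) y.1.1, rep c.2 (crd c'.2) y.1.2, fibre_transition c c' y).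

(** The new fibre coordinate is the value on a new elementary jet, whose
    expansion in the old elementary jets has the Jacobians as coefficients. *)
Lemma crd_transition c c' u : dom c u -> dom c' u ->
  crd c' u = bundle_transition c c' (crd c u).
Proof.
move=> cu c'u; have [ct cx] := cu; have [c't c'x] := c'u.
rewrite /bundle_transition /= (rep_crd sT _ ct) (rep_crd sM _ cx).
congr (_, _, _); apply/matrixP => b j; rewrite !mxE.
rewrite (covec_chart cu); last exact: elem_jet_jet.
rewrite (pair_bigA _ (fun e k => jac c.1 c'.1 (crd c.1 (src u)) b e *
  jac c'.2 c.2 (rep c.2 (crd c'.2) (crd c.2 (tgt u))) k j * (crd c u).2 e k)) /=.
apply: eq_bigr => -[e k] _ /=; congr (_ * _).
rewrite /elem_jet asboolT; last exact: coord_vec_tangent.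
change ((coord_vec TA c.1 (delta_mx ord0 e) (src u) c'.1 ord0 b *:
  coord_vec MA c'.2 (delta_mx ord0 j) (tgt u) c.2) ord0 k =
  jac c.1 c'.1 (crd c.1 (src u)) b e *
  jac c'.2 c.2 (rep c.2 (crd c'.2) (crd c.2 (tgt u))) k j).
rewrite mxE (rep_crd sM _ cx) !coord_vecE// /jac /jac.
by rewrite !deriveE//; exact: transition_differentiable.
Qed.

Lemma overlap_image c c' : crd c @` (dom c `&` dom c') =
  (crd c.1 @` (dom c.1 `&` dom c'.1)) `*` (crd c.2 @` (dom c.2 `&` dom c'.2))
  `*` [set: 'M[R]_(m, n)].
Proof.
apply/seteqP; split=> [_ [u [[ct cx] [c't c'x]] <-]|].
  by split=> //=; split; [exists (src u)|exists (tgt u)].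
move=> [[_ _] p] [[/= [t [ct c't] <-] [x [cx c'x] <-]] _].
have [u [ut ux] up] := crd_surjective p ct cx.
by exists u => //; split; split; rewrite ?ut ?ux.
Qed.

Lemma open_overlap c c' : open (crd c @` (dom c `&` dom c')).
Proof.
rewrite overlap_image; apply: open_setX; last exact: openT.
by apply: open_setX; exact: atlas_overlap.
Qed.

Lemma bundle_transition_smooth c c' :
  smooth_on (crd c @` (dom c `&` dom c')) (bundle_transition c c').
Proof.
have oU := @open_overlap c c'.
set U := _ @` _ in oU *.
have UE : U = _ := overlap_image c c'.
have fT := atlas_findim sT; have fM := atlas_findim sM.
have s11 : smooth_on U (fun y : VE R m n => y.1.1).
  exact: smooth_clin (clin_comp (clin_fst _ _) (clin_fst _ _)).
have s12 : smooth_on U (fun y : VE R m n => y.1.2).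
  exact: smooth_clin (clin_comp (clin_fst _ _) (clin_snd _ _)).
have U1 y : U y -> (crd c.1 @` (dom c.1 `&` dom c'.1)) y.1.1 by rewrite UE => -[[]].
have U2 y : U y -> (crd c.2 @` (dom c.2 `&` dom c'.2)) y.1.2 by rewrite UE => -[[]].
have st : smooth_on U (fun y : VE R m n => rep c.1 (crd c'.1) y.1.1).
  exact: smooth_comp U1 s11 (atlas_transition sT _ _).
have sx : smooth_on U (fun y : VE R m n => rep c.2 (crd c'.2) y.1.2).
  exact: smooth_comp U2 s12 (atlas_transition sM _ _).
apply: smooth_pair => //; first exact: smooth_pair.
apply: smooth_mx => // b j.
have S : smooth_on U (fun y : VE R m n => \sum_e \sum_k (jac c.1 c'.1 y.1.1 b e *
    jac c'.2 c.2 (rep c.2 (crd c'.2) y.1.2) k j) * y.2 e k : R^o).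
  apply: smooth_sum => // e; apply: smooth_sum => // k.
  apply: smooth_mul => //; last first.
    apply: (smooth_clincomp oU (clin_coord e k)).
    exact: smooth_clin (clin_snd _ _).
  apply: smooth_mul => //.
    apply: (smooth_clincomp oU (clin_coord ord0 b)).
    exact: smooth_comp U1 s11 (smooth_derive _ (atlas_transition sT _ _)).
  apply: (smooth_clincomp oU (clin_coord ord0 k)).
  apply: (smooth_comp fM fM oU _ sx (smooth_derive _ (atlas_transition sM c'.2 c.2))).
  move=> y /U2[x [cx c'x] <-]; rewrite (rep_crd sM _ cx).
  by exists x.
by apply: (eq_smooth oU) S => y _; rewrite mxE.
Qed.

Lemma dual_jet_smooth_atlas : smooth_atlas EA.
Proof.
have I c : set_inj (dom c) (crd c).
  move=> u u'; rewrite !inE => cu cu' E.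
  have [cut cux] := cu; have [cut' cux'] := cu'.
  have tt : src u = src u'.
    have Et : crd c.1 (src u) = crd c.1 (src u') := congr1 (fst \o fst) E.
    exact: (atlas_inj sT (mem_set cut) (mem_set cut') Et).
  have xx : tgt u = tgt u'.
    have Ex : crd c.2 (tgt u) = crd c.2 (tgt u') := congr1 (snd \o fst) E.
    exact: (atlas_inj sM (mem_set cux) (mem_set cux') Ex).
  apply: (dual_jet_eq tt xx) => F jF.
  have jF' : jet (src u') (tgt u') F by rewrite -tt -xx.
  rewrite (covec_chart cu jF) (covec_chart cu' jF').
  apply: eq_bigr => k _; rewrite tt.
  by apply: congr1; exact: (congr1 (fun y : VE R m n => y.2 k.1 k.2) E).
split=> // [c c'|c c'|].
- exact: open_overlap.
- apply: (eq_smooth (@open_overlap c c')) (bundle_transition_smooth c c').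
  move=> _ [u [cu c'u] <-]; rewrite -crd_transition//; symmetry.
  apply: xget_unique; first by exists u.
  move=> w [u' [cu' uu' wE]].
  have uE : u' = u by exact: (I c _ _ (mem_set cu') (mem_set cu) uu').
  by move: wE; rewrite uE => wE; exact: (esym wE).
- exact: findim_prod (findim_prod (findim_mx _ _) (findim_mx _ _)) (findim_mx _ _).
Qed.

Let sE : smooth_atlas EA := dual_jet_smooth_atlas.
Let sB : smooth_atlas BA := base_smooth_atlas.

Lemma near_projE d (W : normedModType R) (f : T * M -> W) u : dom d u ->
  \forall y \near crd d u, (rep (d : chart BA) f \o fst) y =
    rep d (fun u => f (projE u)) y.
Proof.
move=> du; apply: (near_chart (atlas_open_dom sE d) du du) => u' du' _ /=.
by rewrite (rep_crd sE _ du') [LHS](rep_crd sB (c := d) f (u := projE u')).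
Qed.

(** In induced coordinates the bundle projection is the first projection. *)
Lemma diff_projE d (d' : chart BA) u e : dom d u -> dom d' (projE u) ->
  differentiable (rep d (fun u => crd d' (projE u))) (crd d u) /\
  'd (rep d (fun u => crd d' (projE u))) (crd d u) e =
  'd (rep (d : chart BA) (crd d')) (crd (d : chart BA) (projE u)) e.1.
Proof.
move=> du d'u.
have dt := transition_differentiable sB (c := d) (u := projE u) du d'u.
have df := clin_differentiable (crd d u) (clin_fst _ _ :
  clin (fst : VE R m n -> 'rV[R]_m * 'rV[R]_n)).
have dc := differentiable_comp df dt.
have N := near_projE (crd d') du.
split; first exact: near_eq_differentiable N dc.
rewrite -(near_eq_diff e N dc) (diff_comp df dt) /=.
by rewrite (clin_diff _ (clin_fst _ _)).
Qed.

(** The tangent map chooses some chart to read the vector; tangency makes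
    the result independent of that choice. *)
Lemma tangent_map_projE c u v : dom c u -> tangent EA u v ->
  tangent_map EA BA (@projE _ _ _ T M) u v = coord_vec BA c (v c).1 (projE u).
Proof.
move=> cu [tv _]; apply/funext => d'.
have [d'u|d'u] := pselect (dom d' (projE u)); last first.
  by rewrite coord_vecN//; apply: xgetPN => w [d [_ ]].
rewrite coord_vecE//.
have H d : dom d u -> 'd (rep d (fun u => crd d' (projE u))) (crd d u) (v d) =
  'd (rep (c : chart BA) (crd d')) (crd (c : chart BA) (projE u)) (v c).1.
  move=> du; have [_ <-] := diff_projE (v c) cu d'u.
  have [dd _] := diff_projE (v d) du d'u.
  apply: (etrans _ (esym (rep_diff_change sE (v c) cu du dd))).
  by apply: congr1; exact: (tv c d cu du).
apply: xget_unique; first by exists c; split=> //; exact: (esym (H c cu)).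
by move=> w [d [du _ ->]]; exact: H.
Qed.

Lemma coord_vec_base_inj c u e e' : dom c u ->
  coord_vec BA c e (projE u) = coord_vec BA c e' (projE u) -> e = e'.
Proof.
move=> cu E.
rewrite -(coord_vec_self sB (c := c) e (u := projE u) cu) E.
exact: coord_vec_self.
Qed.

Lemma verticalP c u v : dom c u -> tangent EA u v ->
  vertical u v <-> (v c).1 = 0.
Proof.
move=> cu tv; have E : coord_vec BA c 0 (projE u) = 0.
  apply/funext => d; have [du|du] := pselect (dom d (projE u)).
    by rewrite coord_vecE// [LHS]linear0.
  by rewrite coord_vecN.
split=> [[_]|v0]; last by split=> //; rewrite (tangent_map_projE cu)// v0 E.
by rewrite (tangent_map_projE cu tv) -E; exact: coord_vec_base_inj.
Qed.

End DualJetTransition.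

(** * Differentials of the changes of induced coordinates *)

(** A function that is affine along a line has its slope as derivative; this
    applies to the fibre coordinates, in which changes of charts are linear. *)
Lemma derive_affine {R : realType} {V W : normedModType R} (f : V -> W) a v l :
  (forall h : R, f (h *: v + a) - f a = h *: l) -> 'D_v f a = l.
Proof.
move=> fl; apply: cvg_lim => //.
have E : \forall h \near (0 : R)^', cst l h = h^-1 *: ((f \o shift a) (h *: v) - f a).
  apply: filterS (nbhs_dnbhs_neq (0 : R)) => h h0.
  by rewrite /= fl scalerA mulVf// scale1r.
apply: cvg_trans (near_eq_cvg E) _; exact: cvg_cst.
Qed.

Section TransitionDifferential.
Context {R : realType} {m n : nat} {T : manifold R m} {M : manifold R n}.

Local Notation MA := (matlas M).
Local Notation EA := (EA T M).
Implicit Types (c d : chart EA) (u : dual_jet T M).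

Let sM : smooth_atlas MA := manifold_smooth_atlas M.
Let sE : smooth_atlas EA := dual_jet_smooth_atlas.

(** Named so that it can be treated as one continuous linear map. *)
Definition entryp (b : 'I_m) (j : 'I_n) (y : VE R m n) : R^o := y.2 b j.

Lemma clin_entryp b j : clin (entryp b j).
Proof. exact: clin_comp (clin_snd _ _) (clin_coord b j). Qed.

Lemma pder_pcoord c c' u b j e : dom c u -> dom c' u ->
  pder c (pcoord c' b j) e u = entryp b j ('d (rep c (crd c')) (crd c u) e).
Proof.
move=> cu c'u; have dx := transition_differentiable sE cu c'u.
exact: (pder_clin sE e (clin_entryp b j) cu dx).
Qed.

(** The base coordinates of a point of E^* transform among themselves;
    differentiating this factorization gives the base parts of the differential
    of a change of induced coordinates, for T and for M alike. *)
Lemma diff_transition_factor {p : nat} {X : manifold R p} (q : dual_jet T M -> X)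
  (L : VE R m n -> 'rV[R]_p) (k k' : chart (matlas X)) c c' u e :
  clin L ->
  (forall u, dom c u -> dom k (q u)) ->
  (forall u, dom c' u -> dom k' (q u)) ->
  (forall u, crd k (q u) = L (crd c u)) ->
  (forall u, crd k' (q u) = L (crd c' u)) ->
  dom c u -> dom c' u ->
  L ('d (rep c (crd c')) (crd c u) e) =
  'd (rep k (crd k')) (crd k (q u)) (L e).
Proof.
move=> cL ck ck' kL kL' cu c'u; have sX := manifold_smooth_atlas X.
have dt := transition_differentiable sE cu c'u.
have dL := clin_differentiable (crd c u) cL.
have dk : differentiable (rep k (crd k')) (L (crd c u)).
  by rewrite -kL; apply: (transition_differentiable sX); [exact: ck|exact: ck'].
have N : \forall y \near crd c u, (rep k (crd k') \o L) y = L (rep c (crd c') y).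
  apply: (near_chart (atlas_open_dom sE c') cu c'u) => u' cu' c'u'.
  rewrite (rep_crd sE (crd c') cu') -(kL' u').
  apply: (etrans (congr1 (rep k (crd k')) (esym (kL u')))).
  exact: (rep_crd sX (crd k') (ck u' cu')).
have E1 := near_eq_diff e N (differentiable_comp dL dk).
have E2 : 'd (L \o rep c (crd c')) (crd c u) e =
    L ('d (rep c (crd c')) (crd c u) e).
  by rewrite (diff_comp dt (clin_differentiable _ cL)) /= (clin_diff _ cL).
rewrite -E2; apply: (etrans (esym E1)).
by rewrite (diff_comp dL dk) /= (clin_diff _ cL) kL.
Qed.

Lemma diff_transition_t c c' u e : dom c u -> dom c' u ->
  ('d (rep c (crd c')) (crd c u) e).1.1 =
  'd (rep c.1 (crd c'.1)) (crd c.1 (src u)) e.1.1.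
Proof.
apply: (diff_transition_factor (q := @src _ _ _ T M) (L := fst \o fst)) => //.
- exact: clin_comp (clin_fst _ _) (clin_fst _ _).
- by move=> u' [].
- by move=> u' [].
Qed.

Lemma diff_transition_x c c' u e : dom c u -> dom c' u ->
  ('d (rep c (crd c')) (crd c u) e).1.2 =
  'd (rep c.2 (crd c'.2)) (crd c.2 (tgt u)) e.1.2.
Proof.
apply: (diff_transition_factor (q := @tgt _ _ _ T M) (L := snd \o fst)) => //.
- exact: clin_comp (clin_fst _ _) (clin_snd _ _).
- by move=> u' [].
- by move=> u' [].
Qed.

(** The new fibre coordinates are linear in the old ones, with products of
    Jacobian entries as coefficients. *)
Lemma pder_dirp c c' u b j e k : dom c u -> dom c' u ->
  pder c (pcoord c' b j) (dirp R e k) u =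
  pder c.1 (tcoord c'.1 b) (delta_mx ord0 e) (src u) *
  pder c'.2 (xcoord c.2 k) (delta_mx ord0 j) (tgt u).
Proof.
move=> cu c'u; have [ct cx] := cu; have [c't c'x] := c'u.
have N : \forall y \near crd c u,
    rep c (pcoord c' b j) y = fibre_transition c c' y b j.
  apply: (near_chart (atlas_open_dom sE c') cu c'u) => u' cu' c'u'.
  rewrite (rep_crd sE (pcoord c' b j) cu').
  exact: (congr1 (entryp b j) (crd_transition cu' c'u')).
rewrite (pder_coord b e ct c't) (pder_coord k j c'x cx).
rewrite /pder (near_eq_derive _ N).
rewrite -[in RHS](rep_crd sM (crd c'.2) cx).
apply: derive_affine => h.
rewrite !mxE -sumrB (bigD1 e)//= [X in _ + X]big1 ?addr0 => [|a ae].
  rewrite -sumrB (bigD1 k)//= [X in _ + X]big1 ?addr0 => [|i ik].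
    rewrite !mxE !eqxx !scaler0 !add0r /= -mulrBr addrK.
    by rewrite mulr1 mulrC.
  by rewrite !mxE !scaler0 !add0r eqxx (negPf ik) /= mulr0 add0r subrr.
rewrite -sumrB big1// => i _.
by rewrite !mxE !scaler0 !add0r (negPf ae) /= mulr0 add0r subrr.
Qed.

Lemma base_sum_delta (w : 'rV[R]_m * 'rV[R]_n) :
  w = \sum_a w.1 ord0 a *: (delta_mx ord0 a, 0) +
      \sum_i w.2 ord0 i *: (0, delta_mx ord0 i).
Proof.
apply: injective_projections.
  rewrite raddfD /= !raddf_sum /= [X in _ + X]big1 ?addr0 => [|i _].
    exact: rowv_sum_delta.
  by rewrite scaler0.
rewrite raddfD /= !raddf_sum /= [X in X + _]big1 ?add0r => [|i _].
  exact: rowv_sum_delta.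
by rewrite scaler0.
Qed.

Lemma VE_sum_delta (y : VE R m n) :
  y = (\sum_a y.1.1 ord0 a *: dirt R n a + \sum_i y.1.2 ord0 i *: dirx R m i)
    + \sum_b \sum_j y.2 b j *: dirp R b j.
Proof.
apply: injective_projections.
  rewrite !raddfD /= !raddf_sum /= [X in _ + X]big1 ?addr0 => [|b _].
    exact: base_sum_delta.
  by rewrite raddf_sum big1// => j _; rewrite /= scaler0.
rewrite !raddfD /= !raddf_sum /= ?[X in X + _ + _]big1 ?[X in _ + X + _]big1 ?add0r => [|a _|i _].
- rewrite [LHS]matrix_sum_delta; apply: eq_bigr => b _.
  by rewrite raddf_sum.
- by rewrite scaler0.
- by rewrite scaler0.
Qed.

Lemma diff_transition_p c c' u e b j : dom c u -> dom c' u ->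
  ('d (rep c (crd c')) (crd c u) e).2 b j =
  (\sum_a e.1.1 ord0 a * pder c (pcoord c' b j) (dirt R n a) u +
   \sum_i e.1.2 ord0 i * pder c (pcoord c' b j) (dirx R m i) u) +
  \sum_h \sum_k e.2 h k *
    (pder c.1 (tcoord c'.1 b) (delta_mx ord0 h) (src u) *
     pder c'.2 (xcoord c.2 k) (delta_mx ord0 j) (tgt u)) :> R.
Proof.
move=> cu c'u; have [lp _] := clin_entryp b j.
have [L LE] := linear_pack lp.
pose D := 'd (rep c (crd c')) (crd c u).
have P f : pder c (pcoord c' b j) f u = L (D f).
  by rewrite -LE; exact: pder_pcoord.
have LD (a : R) y : L (D (a *: y)) = a * L (D y) by rewrite !linearZ.
transitivity (L (D e)); first by rewrite -LE.
rewrite {1}(VE_sum_delta e) !raddfD /= !raddf_sum /=.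
congr (_ + _ + _).
- by apply: eq_bigr => a _; rewrite P; exact: LD.
- by apply: eq_bigr => a _; rewrite P; exact: LD.
- apply: eq_bigr => h _; rewrite !raddf_sum; apply: eq_bigr => k _.
  by rewrite -(pder_dirp _ _ _ _ cu c'u) P; exact: LD.
Qed.

End TransitionDifferential.

(** * The transformation rules *)

Section TransformationRules.
Context {R : realType} {m n : nat} {T : manifold R m} {M : manifold R n}.

Local Notation EA := (EA T M).
Implicit Types (c d : chart EA) (u : dual_jet T M) (N : local_functions T M).

Let sE : smooth_atlas EA := dual_jet_smooth_atlas.

(** The linear map from base parts to fibre parts whose matrix is N; the
    horizontal space is the graph of its opposite. *)
Definition hmat N u (w : 'rV[R]_m * 'rV[R]_n) : 'M[R]_(m, n) :=
  \matrix_(b, j) (\sum_a N1 N b j a u * w.1 ord0 a + \sum_i N2 N b j i u * w.2 ord0 i).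

(** The point over w of the graph that defines the horizontal space. *)
Definition hvec N u (w : 'rV[R]_m * 'rV[R]_n) : VE R m n := (w, - hmat N u w).

Lemma hmat_linear N u : linear (hmat N u).
Proof.
move=> a v w; apply/matrixP => b j; rewrite !mxE mulrDr !mulr_sumr.
rewrite addrACA -!big_split /=; congr (_ + _); apply: eq_bigr => k _.
  by rewrite !mxE mulrDr mulrCA.
by rewrite !mxE mulrDr mulrCA.
Qed.

Lemma hvec_linear N u : linear (hvec N u).
Proof.
move=> a v w; rewrite /hvec hmat_linear; apply: injective_projections => //=.
by rewrite opprD scalerN.
Qed.

Lemma sum_mul_delta p (f : 'I_p -> R) k :
  \sum_i f i * (delta_mx ord0 k : 'rV[R]_p) ord0 i = f k.
Proof.
rewrite (bigD1 k)//= big1 => [|i ik]; first by rewrite mxE !eqxx mulr1 addr0.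
by rewrite mxE (negPf ik) mulr0.
Qed.

Lemma sum_mul_0 p (f : 'I_p -> R) :
  \sum_i f i * (0 : 'rV[R]_p) ord0 i = 0.
Proof. by rewrite big1// => i _; rewrite mxE mulr0. Qed.

Lemma hmat_t N u a b j : hmat N u (delta_mx ord0 a, 0) b j = N1 N b j a u.
Proof. by rewrite mxE /= sum_mul_delta sum_mul_0 addr0. Qed.

Lemma hmat_x N u i b j : hmat N u (0, delta_mx ord0 i) b j = N2 N b j i u.
Proof. by rewrite mxE /= sum_mul_delta sum_mul_0 add0r. Qed.

Lemma sum_exchange1 p q (f : 'I_p -> R) (J : 'I_p -> 'I_q -> R) (w : 'I_q -> R) :
  \sum_e f e * (\sum_a J e a * w a) = \sum_a (\sum_e f e * J e a) * w a.
Proof.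
under eq_bigr do rewrite mulr_sumr; rewrite exchange_big /=.
by apply: eq_bigr => a _; rewrite mulr_suml; apply: eq_bigr => e _; rewrite mulrA.
Qed.

Lemma sum_exchange2 p q r (f : 'I_p -> 'I_q -> 'I_r -> R) (J : 'I_p -> R)
  (K : 'I_q -> R) (w : 'I_r -> R) :
  \sum_h \sum_k (\sum_a f h k a * w a) * (J h * K k) =
  \sum_a (\sum_h \sum_k f h k a * J h * K k) * w a.
Proof.
under eq_bigr => h _.
  under eq_bigr => k _ do rewrite mulr_suml.
  rewrite exchange_big /=; over.
rewrite exchange_big /=; apply: eq_bigr => a _.
rewrite mulr_suml; apply: eq_bigr => h _; rewrite mulr_suml; apply: eq_bigr => k _.
by rewrite mulrAC !mulrA.
Qed.

(** The rules are moved to one side, so that [hvec_defect] can measure by how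
    much they fail. *)
Definition defect_t c c' N N' u b j a : R :=
  \sum_e N1 N' b j e u * pder c.1 (tcoord c'.1 e) (delta_mx ord0 a) (src u) -
  (\sum_e \sum_k N1 N e k a u *
     pder c.1 (tcoord c'.1 b) (delta_mx ord0 e) (src u) *
     pder c'.2 (xcoord c.2 k) (delta_mx ord0 j) (tgt u)
   - pder c (pcoord c' b j) (dirt R n a) u).

Definition defect_x c c' N N' u b j i : R :=
  \sum_k N2 N' b j k u * pder c.2 (xcoord c'.2 k) (delta_mx ord0 i) (tgt u) -
  (\sum_e \sum_k N2 N e k i u *
     pder c.1 (tcoord c'.1 b) (delta_mx ord0 e) (src u) *
     pder c'.2 (xcoord c.2 k) (delta_mx ord0 j) (tgt u)
   - pder c (pcoord c' b j) (dirx R m i) u).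

Lemma transform_defect c c' N N' :
  transform_rules c c' N N' <->
  forall u, dom c u -> dom c' u -> forall b j,
    (forall a, defect_t c c' N N' u b j a = 0) /\
    (forall i, defect_x c c' N N' u b j i = 0).
Proof.
split=> H u cu c'u b j; have [Ht Hx] := H u cu c'u b j.
  by split=> k; apply/eqP; rewrite subr_eq0; apply/eqP; [exact: Ht|exact: Hx].
by split=> k; apply: subr0_eq; [exact: Ht|exact: Hx].
Qed.

Lemma sum_defect p (U S P w : 'I_p -> R) :
  \sum_a (U a - (S a - P a)) * w a =
  \sum_a U a * w a - \sum_a S a * w a + \sum_a w a * P a.
Proof.
rewrite -sumrB -big_split /=; apply: eq_bigr => a _.
by rewrite mulrBl mulrBl opprB addrA addrAC (mulrC (w a)).
Qed.

(** The image of a graph vector misses the graph of the other chart by the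
    defects of the transformation rules, applied to the base part w. *)
Lemma hvec_defect c c' N N' u w b j : dom c u -> dom c' u ->
  let y := 'd (rep c (crd c')) (crd c u) (hvec N u w) in
  y.2 b j + hmat N' u y.1 b j =
  \sum_a defect_t c c' N N' u b j a * w.1 ord0 a +
  \sum_i defect_x c c' N N' u b j i * w.2 ord0 i.
Proof.
move=> cu c'u y; have [ct cx] := cu; have [c't c'x] := c'u.
have y2 : y.2 b j = _ := diff_transition_p (hvec N u w) b j cu c'u.
have y11 : y.1.1 = _ := diff_transition_t (hvec N u w) cu c'u.
have y12 : y.1.2 = _ := diff_transition_x (hvec N u w) cu c'u.
pose J h : R := pder c.1 (tcoord c'.1 b) (delta_mx ord0 h) (src u).
pose K k : R := pder c'.2 (xcoord c.2 k) (delta_mx ord0 j) (tgt u).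
have E2 : \sum_h \sum_k (hvec N u w).2 h k * (J h * K k) =
    - (\sum_a (\sum_h \sum_k N1 N h k a u * J h * K k) * w.1 ord0 a +
       \sum_i (\sum_h \sum_k N2 N h k i u * J h * K k) * w.2 ord0 i).
  rewrite -!sum_exchange2 -big_split /= -sumrN; apply: eq_bigr => h _.
  rewrite -big_split /= -sumrN; apply: eq_bigr => k _.
  by rewrite !mxE mulNr mulrDl.
have E3 : hmat N' u y.1 b j =
    \sum_a (\sum_e N1 N' b j e u *
      pder c.1 (tcoord c'.1 e) (delta_mx ord0 a) (src u)) * w.1 ord0 a +
    \sum_i (\sum_k N2 N' b j k u *
      pder c.2 (xcoord c'.2 k) (delta_mx ord0 i) (tgt u)) * w.2 ord0 i.
  rewrite mxE y11 y12 -!sum_exchange1; congr (_ + _); apply: eq_bigr => e _.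
    by apply: congr1; exact: (diff_pder _ _ ct c't).
  by apply: congr1; exact: (diff_pder _ _ cx c'x).
rewrite y2 E3 E2 /defect_t /defect_x !sum_defect.
have rearrange (A1 A2 A3 A4 A5 A6 : R) :
  A1 + A2 - (A3 + A4) + (A5 + A6) = A5 - A3 + A1 + (A6 - A4 + A2) by ring.
exact: rearrange.
Qed.

(** Geometric meaning of the rules: the differential of the change of
    coordinates sends horizontal vectors to horizontal vectors. *)
Lemma transform_rulesP c c' N N' :
  transform_rules c c' N N' <->
  forall u v, dom c u -> dom c' u -> tangent EA u v ->
    v c = hvec N u (v c).1 -> v c' = hvec N' u (v c').1.
Proof.
rewrite transform_defect; split=> [H u v cu c'u tv vc|H u cu c'u b j].
  apply: injective_projections => //=; apply/matrixP => b j.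
  have := hvec_defect N N' (v c).1 b j cu c'u.
  have [Ht Hx] := H u cu c'u b j.
  rewrite -vc -(tv.1 c c' cu c'u) big1 => [|a _]; last by rewrite Ht mul0r.
  rewrite big1 ?addr0 => [E|i _]; last by rewrite Hx mul0r.
  by rewrite [RHS]mxE; apply/eqP; rewrite -subr_eq0 opprK; apply/eqP; exact: E.
(* The defects vanish as a linear form in w; basis vectors then isolate them. *)
have D (w : 'rV[R]_m * 'rV[R]_n) : \sum_a defect_t c c' N N' u b j a * w.1 ord0 a +
    \sum_i defect_x c c' N N' u b j i * w.2 ord0 i = 0.
  rewrite -(hvec_defect N N' w b j cu c'u).
  set v := coord_vec EA c (hvec N u w) u.
  have tv : tangent EA u v by exact: coord_vec_tangent.
  have vc : v c = hvec N u w by exact: coord_vec_self.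
  have E : v c' = hvec N' u (v c').1 by apply: (H u v cu c'u tv); rewrite vc.
  rewrite (tv.1 c c' cu c'u) vc in E.
  apply: (etrans (congr1 (fun z => z + _) (congr1 (entryp b j) E))).
  by rewrite /entryp /= mxE addNr.
split=> [a|i].
  by have := D (delta_mx ord0 a, 0); rewrite /= sum_mul_delta sum_mul_0 addr0.
by have := D (0, delta_mx ord0 i); rewrite /= sum_mul_delta sum_mul_0 add0r.
Qed.

End TransformationRules.

(** * Horizontal lifts of a nonlinear connection *)

Section HorizontalLift.
Context {R : realType} {m n : nat} {T : manifold R m} {M : manifold R n}.

Local Notation EA := (EA T M).
Local Notation field := (dual_jet T M -> chart EA -> VE R m n).
Implicit Types (c d : chart EA) (u : dual_jet T M) (N : local_functions T M).
Implicit Types (w : 'rV[R]_m * 'rV[R]_n).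

Let sE : smooth_atlas EA := dual_jet_smooth_atlas.

(** Flattens the base part into one row, so that the base parts of several
    vectors can be stacked into a matrix. *)
Definition brow w : 'rV[R]_(m + n) := row_mx w.1 w.2.

Lemma brow_linear : linear brow.
Proof. by move=> a v w; rewrite /brow scale_row_mx add_row_mx. Qed.

Lemma brow_inj : injective brow.
Proof. by move=> [v1 v2] [w1 w2] /eq_row_mx[/= -> ->]. Qed.

Lemma clin_brow j : clin (fun w => brow w ord0 j : R^o).
Proof.
have [k ->|k ->] := split_ordP j.
  rewrite (_ : (fun w => _) = fun w => w.1 ord0 k : R^o).
    exact: (clin_comp (clin_fst _ _) (clin_coord ord0 k)).
  by apply/funext => w; rewrite /brow row_mxEl.
rewrite (_ : (fun w => _) = fun w => w.2 ord0 k : R^o).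
  exact: (clin_comp (clin_snd _ _) (clin_coord ord0 k)).
by apply/funext => w; rewrite /brow row_mxEr.
Qed.

Lemma chart_around u : exists c, dom c u.
Proof.
have [ct cut] := manifold_cover (src u); have [cx cux] := manifold_cover (tgt u).
by exists (ct, cx).
Qed.

Section Connection.
Context (H : dual_jet T M -> set (chart EA -> VE R m n)).
Context (cH : nonlinear_connection H).

Lemma connection_subspace u : linear_subspace (H u).
Proof. by have [[+ _] _] := cH; move=> /(_ u)[]. Qed.

Lemma connection_tangent u v : H u v -> tangent EA u v.
Proof. by have [[+ _] _] := cH; move=> /(_ u)[_]; exact. Qed.

(** The difference of the two vectors is horizontal and vertical, hence 0. *)
Lemma horizontal_eq c u h h' : dom c u -> H u h -> H u h' ->
  (h c).1 = (h' c).1 -> h = h'.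
Proof.
move=> cu Hh Hh' E; have [_ /(_ u)[HW _]] := cH.
have [_ HP] := connection_subspace u.
have Hd : H u (-1 *: h' + h) by exact: HP.
have td := connection_tangent Hd.
have dc : ((-1 *: h' + h) c).1 = 0.
  change (-1 *: (h' c).1 + (h c).1 = 0).
  by rewrite E scaleN1r addNr.
have : (H u `&` vertical u) (-1 *: h' + h).
  by split=> //; exact/(verticalP cu td).
rewrite HW => d0; apply/eqP; rewrite -subr_eq0 addrC -scaleN1r; apply/eqP.
exact: d0.
Qed.

(** Take the horizontal part of any tangent vector with base part w: the
    vertical part that is removed has no base part. *)
Lemma horizontal_lift c u w : dom c u -> exists h, H u h /\ (h c).1 = w.
Proof.
move=> cu; have [_ /(_ u)[_ HW]] := cH.
have tv := coord_vec_tangent sE (w, 0 : 'M[R]_(m, n)) cu.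
have [h [v [Hh Vv E]]] := HW _ tv; exists h; split=> //.
have v0 := (verticalP cu Vv.1).1 Vv.
have := coord_vec_self sE (w, 0 : 'M[R]_(m, n)) cu.
rewrite E => /(congr1 fst) /= => <-.
by change ((h c).1 = (h c).1 + (v c).1); rewrite v0 addr0.
Qed.

Definition hlift c w u : chart EA -> VE R m n :=
  xget 0 [set h | H u h /\ (h c).1 = w].

Lemma hliftP c w u : dom c u -> H u (hlift c w u) /\ (hlift c w u c).1 = w.
Proof.
move=> cu; have [h hP] := horizontal_lift w cu.
suff : [set h | H u h /\ (h c).1 = w] (hlift c w u) by [].
exact: xgetI hP.
Qed.

Section LocalBasis.
Variables (c : chart EA) (k : nat) (Y : 'I_k -> field).

Definition base_matrix u : 'M[R]_(k, m + n) := \matrix_i brow (Y i u c).1.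

Lemma mul_base_matrix u (a : 'rV[R]_k) :
  a *m base_matrix u = brow ((\sum_i a ord0 i *: Y i u) c).1.
Proof.
have [L LE] := linear_pack brow_linear.
rewrite mulmx_sum_row fct_sumE raddf_sum /= LE raddf_sum /=.
apply: eq_bigr => i _; rewrite rowK -LE.
change (a 0 i *: brow (Y i u c).1 = brow (a ord0 i *: (Y i u c).1)).
by rewrite LE linearZ.
Qed.

Lemma basis_in u i : is_basis (fun i => Y i u) (H u) -> H u (Y i u).
Proof.
move=> [_ ->]; exists (fun j => (j == i)%:R).
rewrite (bigD1 i)//= eqxx scale1r big1 ?addr0// => j /negPf ->.
by rewrite scale0r.
Qed.

(** A combination of basis vectors without base part is horizontal and
    vertical, hence 0. *)
Lemma base_matrix_free u : dom c u -> is_basis (fun i => Y i u) (H u) ->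
  row_free (base_matrix u).
Proof.
move=> cu bY; apply: inj_row_free => a; rewrite mul_base_matrix => a0.
have S0 : \sum_i a ord0 i *: Y i u = 0.
  apply: (horizontal_eq cu).
  - apply: subspace_sum; first exact: connection_subspace.
    by move=> i; exact: basis_in.
  - by have [] := connection_subspace u.
  - by apply: brow_inj; rewrite a0; apply/esym; exact: row_mx0.
by apply/rowP => i; rewrite mxE; exact: (bY.1 _ S0).
Qed.

(** Every base part has a horizontal lift, which the basis spans. *)
Lemma base_matrix_full u : dom c u -> is_basis (fun i => Y i u) (H u) ->
  row_full (base_matrix u).
Proof.
move=> cu bY; rewrite -sub1mx; apply/row_subP => j.
set w := (lsubmx (row j (1%:M : 'M[R]_(m + n))), rsubmx (row j (1%:M : 'M[R]_(m + n)))).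
have [h [Hh hw]] := horizontal_lift w cu.
have [a ha] : exists a : 'I_k -> R, h = \sum_i a i *: Y i u.
  by have [_ E] := bY; move: Hh; rewrite E.
apply/submxP; exists (\row_i a i); rewrite mul_base_matrix.
rewrite (_ : \sum_i _ = h); last first.
  by rewrite ha; apply: eq_bigr => i _; rewrite mxE.
by rewrite hw /brow /= hsubmxK.
Qed.

End LocalBasis.

(** Near a given point, the coefficients of the lift in a smooth basis of
    the distribution are the row w multiplied by the inverse of the matrix of
    base parts. *)
Lemma hlift_smooth c w : section_of H (dom c) (hlift c w).
Proof.
split; last by move=> u cu; have [] := hliftP w cu.
apply: (smooth_vector_field_chart sE (c := c)) => //; first exact: atlas_open_dom.
  by move=> u cu; apply: connection_tangent; have [] := hliftP w cu.
apply: smooth_local => _ [u [cu _] <-].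
have [[_ lb] _] := cH.
have [Q [oQ Qu [k [Y [sY bY]]]]] := lb u.
exists (crd c @` (dom c `&` Q)); first by exists u.
(* The rank of the base matrix equals both its height and its width, so it
   is square and thus invertible. *)
have kE : k = (m + n)%N.
  have := base_matrix_free cu (bY u Qu); have := base_matrix_full cu (bY u Qu).
  by rewrite /row_full /row_free => /eqP -> /eqP.
subst k.
set U := crd c @` _; have oU : open U := oQ c.
pose Z i := rep c (fun u => Y i u c).
have sZ i : smooth_on U (Z i) by have [_] := sY i; exact.
pose A y : 'M[R]_(m + n) := \matrix_i brow (Z i y).1.
have AE u' : dom c u' -> A (crd c u') = base_matrix c Y u'.
  move=> cu'; apply/matrixP => i j; rewrite !mxE /Z.
  by rewrite (rep_crd sE (fun u => Y i u c) cu').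
have uA y : U y -> A y \in unitmx.
  move=> [u' [cu' Qu'] <-]; rewrite AE// -row_free_unit.
  exact: base_matrix_free (bY u' Qu').
have sA : smooth_on U A.
  apply: smooth_mx => // i j.
  have S := smooth_clincomp oU (clin_comp (clin_fst _ _) (clin_brow j)) (sZ i).
  by apply: (eq_smooth oU) S => y _; rewrite mxE.
have sI := smooth_invmx oU uA sA.
have S : smooth_on U (fun y => \sum_i ((brow w *m invmx (A y)) ord0 i : R^o) *: Z i y).
  apply: smooth_sum => // i; apply: smooth_scale => //; first exact: atlas_findim sE.
  apply: smooth_entry => //; apply: smooth_mulmx => //; exact: smooth_cst.
apply: (eq_smooth oU) S => _ [u' [cu' Qu'] <-].
rewrite (rep_crd sE (fun u => hlift c w u c) cu') AE//.
set a := _ *m _.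
have E : hlift c w u' = \sum_i a ord0 i *: Y i u'.
  have [Hh hw] := hliftP w cu'.
  apply: (horizontal_eq cu') => //.
    apply: subspace_sum; first exact: connection_subspace.
    by move=> i; apply: basis_in; exact: bY.
  rewrite hw; apply: brow_inj; rewrite -mul_base_matrix.
  by rewrite /a mulmxKV// -row_free_unit; exact: base_matrix_free (bY u' Qu').
rewrite E fct_sumE; apply: eq_bigr => i _.
by rewrite /Z (rep_crd sE (fun u => Y i u c) cu').
Qed.

End Connection.
End HorizontalLift.

(** * The coefficients of a nonlinear connection *)

Section ConnectionCoefficients.
Context {R : realType} {m n : nat} {T : manifold R m} {M : manifold R n}.

Local Notation EA := (EA T M).
Local Notation BA := (BA T M).
Local Notation field := (dual_jet T M -> chart EA -> VE R m n).
Implicit Types (c d : chart EA) (u : dual_jet T M) (N : local_functions T M).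
Implicit Types (w : 'rV[R]_m * 'rV[R]_n).

Let sE : smooth_atlas EA := dual_jet_smooth_atlas.

Local Notation et a := (delta_mx ord0 a, 0) (only parsing).
Local Notation ex i := (0, delta_mx ord0 i) (only parsing).

(** Rewrites the expansion along the fibre directions as one coordinate
    vector, so that expressions of the adapted fields become equations between
    components. *)
Lemma coord_vec_hvec c u e (P : 'M[R]_(m, n)) :
  coord_vec EA c e u - \sum_b \sum_j P b j *: coord_vec EA c (dirp R b j) u =
  coord_vec EA c (e - (0, P)) u.
Proof.
have [L LE] := linear_pack (coord_vec_linear (A := EA) c u).
have LL f : coord_vec EA c f u = L f by rewrite -LE.
have PE : (0, P) = \sum_b \sum_j P b j *: dirp R b j :> VE R m n.
  rewrite [LHS]VE_sum_delta /= [X in X + _ + _]big1 => [|a _]; last by rewrite mxE scale0r.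
  by rewrite [X in _ + X + _]big1 ?add0r// => i _; rewrite mxE scale0r.
have LS : L (\sum_b \sum_j P b j *: dirp R b j) = \sum_b \sum_j P b j *: L (dirp R b j).
  rewrite linear_sum; apply: eq_bigr => b _.
  by rewrite linear_sum; apply: eq_bigr => j _; rewrite linearZ.
rewrite !LL PE; apply: (etrans _ (esym (linearB L _ _))); apply: congr1; apply: congr1.
apply: (etrans _ (esym LS)); apply: eq_bigr => b _; apply: eq_bigr => j _.
by rewrite LL.
Qed.

Lemma hvec_t N u a : hvec N u (et a) = dirt R n a - (0, \matrix_(b, j) N1 N b j a u).
Proof.
apply: injective_projections => /=; first by rewrite subr0.
by rewrite sub0r; congr (- _); apply/matrixP => b j; rewrite hmat_t mxE.
Qed.

Lemma hvec_x N u i : hvec N u (ex i) = dirx R m i - (0, \matrix_(b, j) N2 N b j i u).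
Proof.
apply: injective_projections => /=; first by rewrite subr0.
by rewrite sub0r; congr (- _); apply/matrixP => b j; rewrite hmat_x mxE.
Qed.

Lemma expressedP c (dt : 'I_m -> field) (dx : 'I_n -> field) N :
  expressed c dt dx N <->
  (forall a u, dom c u -> dt a u = coord_vec EA c (hvec N u (et a)) u) /\
  (forall i u, dom c u -> dx i u = coord_vec EA c (hvec N u (ex i)) u).
Proof.
have Et a u : coord_vec EA c (hvec N u (et a)) u = coord_vec EA c (dirt R n a) u -
     \sum_b \sum_j N1 N b j a u *: coord_vec EA c (dirp R b j) u.
  rewrite hvec_t -coord_vec_hvec; congr (_ - _).
  by apply: eq_bigr => b _; apply: eq_bigr => j _; rewrite mxE.
have Ex i u : coord_vec EA c (hvec N u (ex i)) u = coord_vec EA c (dirx R m i) u -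
     \sum_b \sum_j N2 N b j i u *: coord_vec EA c (dirp R b j) u.
  rewrite hvec_x -coord_vec_hvec; congr (_ - _).
  by apply: eq_bigr => b _; apply: eq_bigr => j _; rewrite mxE.
by split=> -[Ht Hx]; split=> k u cu; rewrite ?Et ?Ex ?Ht ?Hx// ?Et ?Ex.
Qed.

Section Connection.
Context (H : dual_jet T M -> set (chart EA -> VE R m n)).
Context (cH : nonlinear_connection H).

(** The conditions on an adapted field, read in the chart. *)
Lemma adapted_horizontal c (dt : 'I_m -> field) (dx : 'I_n -> field) u :
  adapted H c dt dx -> dom c u ->
  (forall a, H u (dt a u) /\ (dt a u c).1 = et a) /\
  (forall i, H u (dx i u) /\ (dx i u c).1 = ex i).
Proof.
move=> [st sx pt px] cu; split=> k.
  have Hk := (st k).2 u cu; split=> //; apply: (coord_vec_base_inj cu).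
  by rewrite -(tangent_map_projE cu (connection_tangent cH Hk)); exact: pt.
have Hk := (sx k).2 u cu; split=> //; apply: (coord_vec_base_inj cu).
by rewrite -(tangent_map_projE cu (connection_tangent cH Hk)); exact: px.
Qed.

Lemma adapted_hlift c :
  adapted H c (fun a => hlift H c (et a)) (fun i => hlift H c (ex i)).
Proof.
have P w u : dom c u ->
    tangent_map EA BA (@projE _ _ _ T M) u (hlift H c w u) = coord_vec BA c w (projE u).
  move=> cu; have [Hh hw] := hliftP cH w cu.
  by rewrite (tangent_map_projE cu (connection_tangent cH Hh)) hw.
by split=> [a|i|a u|i u]; [exact: hlift_smooth|exact: hlift_smooth|exact: P|exact: P].
Qed.

Lemma adapted_indep c (dt : 'I_m -> field) (dx : 'I_n -> field) :
  adapted H c dt dx -> adapted_fields_indep c dt dx.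
Proof.
move=> ad u cu; have [Ht Hx] := adapted_horizontal ad cu => a a0.
pose w : 'rV[R]_m * 'rV[R]_n := (\row_k a (inl k), \row_k a (inr k)).
have w0 : w = 0.
  have := congr1 (fun v : chart EA -> VE R m n => (v c).1) a0.
  rewrite /= fct_sumE raddf_sum big_sumType /= => E.
  rewrite (base_sum_delta w); apply: etrans E; congr (_ + _); apply: eq_bigr => k _.
    by rewrite mxE -(Ht k).2.
  by rewrite mxE -(Hx k).2.
move=> [k|k].
  by have := congr1 (fun w => w.1 ord0 k) w0; rewrite /= !mxE.
by have := congr1 (fun w => w.2 ord0 k) w0; rewrite /= !mxE.
Qed.

Lemma adapted_unique c (dt dt' : 'I_m -> field) (dx dx' : 'I_n -> field) :
  adapted H c dt dx -> adapted H c dt' dx' -> forall u, dom c u ->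
  (forall a, dt' a u = dt a u) /\ (forall i, dx' i u = dx i u).
Proof.
move=> ad ad' u cu; have [Ht Hx] := adapted_horizontal ad cu.
have [Ht' Hx'] := adapted_horizontal ad' cu.
split=> k; apply: (horizontal_eq cH cu).
- by have [] := Ht' k.
- by have [] := Ht k.
- by rewrite (Ht' k).2 (Ht k).2.
- by have [] := Hx' k.
- by have [] := Hx k.
- by rewrite (Hx' k).2 (Hx k).2.
Qed.

Lemma field_coefficient_smooth c (Y : field) b j :
  smooth_vector_field (dom c) Y ->
  smooth_fun EA (dom c) (fun u => - (Y u c).2 b j : R^o).
Proof.
move=> [_ /(_ c) sY] c'.
have oc := atlas_open_dom sE c.
have S : smooth_on (crd c @` (dom c `&` dom c)) (rep c (fun u => - (Y u c).2 b j : R^o)).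
  have := smooth_opp (oc c) (smooth_clincomp (oc c) (clin_entryp b j) sY).
  apply: (eq_smooth (oc c)) => _ [u [cu _] <-].
  rewrite (rep_crd sE (fun u => Y u c) cu).
  by rewrite (rep_crd sE (fun u => - (Y u c).2 b j : R^o) cu).
apply: smooth_sub (smooth_rep_change sE c' findim_R oc S).
by move=> _ [u [c'u cu] <-]; exists u.
Qed.

Lemma adapted_expressed c (dt : 'I_m -> field) (dx : 'I_n -> field) :
  adapted H c dt dx ->
  exists N, smooth_functions c N /\ expressed c dt dx N.
Proof.
move=> ad; have [st sx _ _] := ad.
pose N : local_functions T M := LocalFunctions
  (fun b j a u => - (dt a u c).2 b j) (fun b j i u => - (dx i u c).2 b j).
exists N; split.
  by split=> b j k; apply: field_coefficient_smooth; [have [] := st k|have [] := sx k].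
apply/expressedP; split=> k u cu; have [Ht Hx] := adapted_horizontal ad cu.
  rewrite {1}(tangent_coord_vec cu (connection_tangent cH (Ht k).1)); congr coord_vec.
  apply: injective_projections; first by rewrite (Ht k).2.
  by apply/matrixP => b j; rewrite /= mxE hmat_t /= opprK.
rewrite {1}(tangent_coord_vec cu (connection_tangent cH (Hx k).1)); congr coord_vec.
apply: injective_projections; first by rewrite (Hx k).2.
by apply/matrixP => b j; rewrite /= mxE hmat_x /= opprK.
Qed.

(** The adapted fields take values in H and have graph vectors as components;
    by linearity the whole graph lies in H, and H is no larger since horizontal
    vectors are determined by their base parts. *)
Lemma horizontalP c N u v : coefficients_of H c N -> dom c u ->
  H u v <-> tangent EA u v /\ v c = hvec N u (v c).1.
Proof.
move=> [dt [dx [ad /expressedP[Et Ex]]]] cu.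
have [Ht Hx] := adapted_horizontal ad cu.
have lift w : exists2 h, H u h & h c = hvec N u w.
  have lH := connection_subspace cH u.
  exists (\sum_a w.1 ord0 a *: dt a u + \sum_i w.2 ord0 i *: dx i u).
    have [_ HP] := lH; rewrite -[X in X + _]scale1r; apply: HP.
      by apply: subspace_sum => // a; have [] := Ht a.
    by apply: subspace_sum => // i; have [] := Hx i.
  have [L LE] := linear_pack (hvec_linear N u).
  rewrite [in RHS](base_sum_delta w) LE linearD !linear_sum -LE.
  transitivity ((\sum_a w.1 ord0 a *: dt a u) c + (\sum_i w.2 ord0 i *: dx i u) c) => //.
  rewrite !fct_sumE; congr (_ + _); apply: eq_bigr => k _.
    rewrite (Et k u cu) LE linearZ -LE.
    transitivity (w.1 ord0 k *: coord_vec EA c (hvec N u (delta_mx ord0 k, 0)) u c) => //.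
    by rewrite coord_vec_self.
  rewrite (Ex k u cu) LE linearZ -LE.
  transitivity (w.2 ord0 k *: coord_vec EA c (hvec N u (0, delta_mx ord0 k)) u c) => //.
  by rewrite coord_vec_self.
split=> [Hv|[tv vc]].
  split; first exact: connection_tangent Hv.
  have [h Hh hc] := lift (v c).1.
  have -> // : v = h by apply: (horizontal_eq cH cu Hv Hh); rewrite hc.
  by rewrite hc.
have [h Hh hc] := lift (v c).1.
by rewrite (tangent_eq cu tv (connection_tangent cH Hh))// hc.
Qed.

(** Both families describe the same graph, and a graph determines its
    linear map. *)
Lemma coefficients_unique c N N' :
  coefficients_of H c N -> coefficients_of H c N' -> eq_on (dom c) N N'.
Proof.
move=> CN CN'.
have E u w : dom c u -> hmat N u w = hmat N' u w.
  move=> cu; pose v := coord_vec EA c (hvec N u w) u.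
  have vc : v c = hvec N u w by exact: coord_vec_self.
  have Hv : H u v.
    by apply/(horizontalP v CN cu); split; [exact: coord_vec_tangent|rewrite vc].
  have [_] := (horizontalP v CN' cu).1 Hv.
  by rewrite vc => /(congr1 snd)/= /oppr_inj.
by split=> b j k u cu; rewrite -?hmat_t -?hmat_x E.
Qed.

Lemma coefficients_transform c c' N N' :
  coefficients_of H c N -> coefficients_of H c' N' -> transform_rules c c' N N'.
Proof.
move=> CN CN'; apply/transform_rulesP => u v cu c'u tv vc.
have Hv : H u v by apply/(horizontalP v CN cu).
by have [_] := (horizontalP v CN' c'u).1 Hv.
Qed.

End Connection.

End ConnectionCoefficients.

(** * The nonlinear connection defined by local functions *)

Section ConnectionOfFunctions.
Context {R : realType} {m n : nat} {T : manifold R m} {M : manifold R n}.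

Local Notation EA := (EA T M).
Local Notation BA := (BA T M).
Implicit Types (c d : chart EA) (u : dual_jet T M).
Implicit Types (w : 'rV[R]_m * 'rV[R]_n).

Let sE : smooth_atlas EA := dual_jet_smooth_atlas.

Lemma smooth_hvec_field c (N : local_functions T M) w : smooth_functions c N ->
  smooth_vector_field (dom c) (fun u => coord_vec EA c (hvec N u w) u).
Proof.
move=> [s1 s2]; apply: (smooth_vector_field_chart sE (c := c)) => //.
- exact: atlas_open_dom.
- by move=> u cu; exact: coord_vec_tangent.
set U := _ @` _; have oU : open U := atlas_open_dom sE c c.
have S : smooth_on U (fun y => (w, - (\matrix_(b, j)
   (\sum_a w.1 ord0 a * rep c (N1 N b j a) y + \sum_i w.2 ord0 i * rep c (N2 N b j i) y)))
   : VE R m n).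
  apply: smooth_pair => //; first exact: smooth_cst.
  apply: smooth_opp => //; apply: smooth_mx => // b j.
  have S : smooth_on U (fun y => \sum_a w.1 ord0 a * rep c (N1 N b j a) y +
     \sum_i w.2 ord0 i * rep c (N2 N b j i) y : R^o).
    apply: smooth_add => //; apply: smooth_sum => // k; apply: smooth_mul => //;
      try exact: smooth_cst.
      exact: s1.
    exact: s2.
  by apply: (eq_smooth oU) S => y _; rewrite mxE.
apply: (eq_smooth oU) S => _ [u [cu _] <-].
rewrite (rep_crd sE (fun u => coord_vec EA c (hvec N u w) u c) cu) coord_vec_self//.
apply: injective_projections => //=; congr (- _); apply/matrixP => b j; rewrite !mxE.
congr (_ + _); apply: eq_bigr => k _.
  by rewrite (rep_crd sE (N1 N b j k) cu) mulrC.
by rewrite (rep_crd sE (N2 N b j k) cu) mulrC.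
Qed.

Context (N : chart EA -> local_functions T M) (fN : connection_functions N).

(** The condition is imposed in all charts at once, which keeps the
    definition free of choices. *)
Definition connection_of u : set (chart EA -> VE R m n) :=
  [set v | tangent EA u v /\ forall c, dom c u -> v c = hvec (N c) u (v c).1].

(** The transformation rules make the condition in one chart imply it in
    all the others. *)
Lemma connection_ofP c u v : dom c u ->
  connection_of u v <-> tangent EA u v /\ v c = hvec (N c) u (v c).1.
Proof.
move=> cu; split=> [[tv vN]|[tv vc]]; split=> //; first exact: vN.
move=> c' c'u; have [_ tN] := fN.
exact: ((transform_rulesP c c' (N c) (N c')).1 (tN c c') u v).
Qed.

Lemma connection_of_lift c u w : dom c u ->
  connection_of u (coord_vec EA c (hvec (N c) u w) u).
Proof.
move=> cu; apply/(connection_ofP _ cu); split; first exact: coord_vec_tangent.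
by rewrite coord_vec_self.
Qed.

Lemma connection_of_subspace u : linear_subspace (connection_of u).
Proof.
have [c cu] := chart_around u; have [t0 tP] := tangent_linear (A := EA) u.
have [L LE] := linear_pack (hvec_linear (N c) u).
split=> [|a v w /(connection_ofP _ cu)[tv vc] /(connection_ofP _ cu)[tw wc]].
  by apply/(connection_ofP _ cu); split=> //; rewrite LE /= linear0.
apply/(connection_ofP _ cu); split; first exact: tP.
change (a *: v c + w c = hvec (N c) u (a *: (v c).1 + (w c).1)).
by rewrite hvec_linear -vc -wc.
Qed.

(** The standard basis of the base, indexed by one ordinal as the definition
    of a smooth distribution requires. *)
Definition base_vec (k : 'I_(m + n)) : 'rV[R]_m * 'rV[R]_n :=
  (lsubmx (delta_mx ord0 k : 'rV[R]_(m + n)), rsubmx (delta_mx ord0 k : 'rV[R]_(m + n))).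

Lemma connection_of_basis c u : dom c u ->
  is_basis (fun k => coord_vec EA c (hvec (N c) u (base_vec k)) u)
  (connection_of u).
Proof.
move=> cu.
pose f (r : 'rV[R]_(m + n)) := coord_vec EA c (hvec (N c) u (lsubmx r, rsubmx r)) u.
have lf : linear f.
  move=> a r s; rewrite /f !linearP.
  by rewrite -coord_vec_linear -hvec_linear.
have [L LE] := linear_pack lf.
have E (a : 'I_(m + n) -> R) : \sum_k a k *: f (delta_mx ord0 k) = f (\row_k a k).
  rewrite [in RHS](rowv_sum_delta (\row_k a k)) LE linear_sum; apply: eq_bigr => k _.
  by rewrite linearZ mxE.
split=> [a|].
  rewrite (E a) => fa0 k.
  have := congr1 (fun v : chart EA -> VE R m n => (v c).1) fa0.
  rewrite /f /= coord_vec_self// => /pair_equal_spec[l0 r0].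
  have : \row_k a k = row_mx 0 0 :> 'rV[R]_(m + n) by rewrite -[LHS]hsubmxK l0 r0.
  by move=> /rowP/(_ k); rewrite row_mx0 !mxE.
apply/seteqP; split=> [v /(connection_ofP _ cu)[tv vc]|_ [a ->]].
  exists (fun k => brow (v c).1 ord0 k).
  rewrite (E _) {1}(tangent_coord_vec cu tv) vc /f; congr (coord_vec _ _ (hvec _ _ _) _).
  rewrite (_ : \row_k _ = brow (v c).1); last by apply/rowP => k; rewrite mxE.
  by rewrite /brow row_mxKl row_mxKr /= -surjective_pairing.
by rewrite (E a); exact: connection_of_lift.
Qed.

Lemma connection_of_nonlinear : nonlinear_connection connection_of.
Proof.
split; [split=> u|move=> u].
- by split; [exact: connection_of_subspace|move=> v []].
- have [c cu] := chart_around u; exists (dom c); split=> //.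
    exact: atlas_open_dom.
  exists (m + n)%N, (fun k u => coord_vec EA c (hvec (N c) u (base_vec k)) u).
  split; last by move=> u' cu'; exact: connection_of_basis.
  by move=> k; apply: smooth_hvec_field; have [+ _] := fN; exact.
have [c cu] := chart_around u; have lH := connection_of_subspace u.
have [L LE] := linear_pack (hvec_linear (N c) u).
split.
  apply/seteqP; split=> [v [/(connection_ofP _ cu)[tv vc] Vv]|_ ->].
    have v0 := (verticalP cu tv).1 Vv.
    apply: (tangent_eq cu tv); first by have [] := tangent_linear (A := EA) u.
    by rewrite vc v0 LE; exact: linear0.
  split; first by have [] := lH.
  have [t0 _] := tangent_linear (A := EA) u.
  exact/(verticalP cu t0).
move=> v tv; pose h := coord_vec EA c (hvec (N c) u (v c).1) u.
have Hh : connection_of u h by exact: connection_of_lift.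
have th : tangent EA u (-1 *: h + v).
  by have [_ tP] := tangent_linear (A := EA) u; apply: tP => //; have [] := Hh.
exists h, (-1 *: h + v); split=> //; last by rewrite scaleN1r addrA subrr add0r.
apply/(verticalP cu th).
change (-1 *: (h c).1 + (v c).1 = 0).
by rewrite /h coord_vec_self//= scaleN1r addNr.
Qed.

Lemma connection_of_coefficients c : coefficients_of connection_of c (N c).
Proof.
have P w u : dom c u ->
    tangent_map EA BA (@projE _ _ _ T M) u (coord_vec EA c (hvec (N c) u w) u) =
    coord_vec BA c w (projE u).
  move=> cu; rewrite (tangent_map_projE cu); last exact: coord_vec_tangent.
  by rewrite coord_vec_self.
have S w : section_of connection_of (dom c) (fun u => coord_vec EA c (hvec (N c) u w) u).
  split; first by apply: smooth_hvec_field; have [+ _] := fN; exact.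
  by move=> u cu; exact: connection_of_lift.
exists (fun a u => coord_vec EA c (hvec (N c) u (delta_mx ord0 a, 0)) u).
exists (fun i u => coord_vec EA c (hvec (N c) u (0, delta_mx ord0 i)) u).
by split; [split=> k; do ?exact: S; exact: P|exact/expressedP].
Qed.

Lemma connection_of_unique H : nonlinear_connection H ->
  (forall c, coefficients_of H c (N c)) -> connection_of = H.
Proof.
move=> cH CN; apply/funext => u; have [c cu] := chart_around u.
by apply/seteqP; split=> v; rewrite (connection_ofP _ cu) (horizontalP cH v (CN c) cu).
Qed.

End ConnectionOfFunctions.

Theorem theorem3p2 (R : realType) (m n : nat)
    (T : manifold R m) (M : manifold R n) :
  (forall H : dual_jet T M -> set (chart (EA T M) -> VE R m n),
     nonlinear_connection H ->
     [/\ (* i *)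
         forall c : chart (EA T M), exists dt dx,
           [/\ adapted H c dt dx, adapted_fields_indep c dt dx &
             forall dt' dx', adapted H c dt' dx' ->
               forall u, dom c u ->
                 (forall a, dt' a u = dt a u) /\ (forall i, dx' i u = dx i u)],
         (* ii *)
         forall (c : chart (EA T M)) dt dx, adapted H c dt dx ->
           exists N : local_functions T M,
             [/\ smooth_functions c N, expressed c dt dx N &
               forall N', expressed c dt dx N' -> eq_on (dom c) N' N] &
         (* iii *)
         forall (c c' : chart (EA T M)) (N N' : local_functions T M),
           coefficients_of H c N -> coefficients_of H c' N' ->
           transform_rules c c' N N']) /\
  (* iv *)
  (forall H : dual_jet T M -> set (chart (EA T M) -> VE R m n),
     nonlinear_connection H ->
     exists N : chart (EA T M) -> local_functions T M,
       [/\ connection_functions N, forall c, coefficients_of H c (N c) &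
         forall N' : chart (EA T M) -> local_functions T M,
           connection_functions N' -> (forall c, coefficients_of H c (N' c)) ->
           forall c, eq_on (dom c) (N' c) (N c)]) /\
  (forall N : chart (EA T M) -> local_functions T M,
     connection_functions N ->
     exists! H : dual_jet T M -> set (chart (EA T M) -> VE R m n),
       nonlinear_connection H /\ forall c, coefficients_of H c (N c)).
Proof.
split=> [H cH|]; last split=> [H cH|N fN].
- split=> [c|c dt dx ad|c c' N N'].
  + exists (fun a => hlift H c (delta_mx ord0 a, 0)).
    exists (fun i => hlift H c (0, delta_mx ord0 i)).
    have ad := adapted_hlift cH c; split=> //; first exact: (adapted_indep cH ad).
    by move=> dt' dx' ad'; exact: (adapted_unique cH ad ad').
  + have [N [sN eN]] := adapted_expressed cH ad; exists N; split=> // N' eN'.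
    by apply: (coefficients_unique cH); exists dt, dx.
  + exact: coefficients_transform.
- have ex c : exists N, smooth_functions c N /\ coefficients_of H c N.
    have ad := adapted_hlift cH c; have [N [sN eN]] := adapted_expressed cH ad.
    exists N; split=> //.
    by exists (fun a => hlift H c (delta_mx ord0 a, 0)),
      (fun i => hlift H c (0, delta_mx ord0 i)).
  have [N NP] := choice ex; exists N; split=> [|c|N' _ CN' c].
  + split=> [c|c c']; first by have [] := NP c.
    by apply: (coefficients_transform cH); [have [] := NP c|have [] := NP c'].
  + by have [] := NP c.
  + by apply: (coefficients_unique cH) => //; have [] := NP c.
- exists (connection_of N); split.
    by split; [exact: connection_of_nonlinear|exact: connection_of_coefficients].
  by move=> H [cH CN]; exact: connection_of_unique.
Qed.
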